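(* Let $f:\mathbb{R}^n\to\mathbb{R}^n$ be a Lipschitz mapping such that $\partial f(x)$ has maximal rank for every $x\in\mathbb{R}^n$. Assume that there exists $x_0\in\mathbb{R}^n$ such that $$\int_0^\infty s(t)\,dt=\infty,\qquad\text{where}\qquad s(t)=\inf\{|\lambda|^n:\ x\in\overline{B}(x_0,t),\ \lambda\in\operatorname{Spec}(\partial f(x))\},$$ and $\overline{B}(x_0,t)$ is the closed ball of center $x_0$ and radius $t$ in $\mathbb{R}^n$. Then $f$ is a global homeomorphism (from $\mathbb{R}^n$ onto $\mathbb{R}^n$).
   Context: For a Lipschitz mapping $f:\mathbb{R}^n\to\mathbb{R}^n$, the Clarke generalized differential $\partial f(x)$ is the convex hull of all limits $\lim_i df(x_i)$ with $x_i\to x$ and $f$ differentiable at each $x_i$, where $df(x_i)$ is identified with the Jacobian matrix. $\partial f(x)$ has maximal rank if every matrix in $\partial f(x)$ is invertible. $\operatorname{Spec}(\partial f(x))$ denotes the set of all complex eigenvalues of all matrices $A\in\partial f(x)$. *)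

(* Defs.v *)
From HB Require Import structures.
From mathcomp Require Import all_boot all_order all_algebra.
From mathcomp Require Import all_classical all_reals all_analysis.
From mathcomp Require Import complex.

Set Implicit Arguments.
Unset Strict Implicit.
Unset Printing Implicit Defensive.

Import Order.TTheory GRing.Theory Num.Theory.
Import numFieldNormedType.Exports.

Local Open Scope classical_set_scope.
Local Open Scope ring_scope.

(* The library norm on 'rV[R]_n is the sup norm, so the Euclidean norm is
   introduced separately; both induce the same topology. *)
Definition enorm (R : realType) (n : nat) (x : 'rV[R]_n) : R :=
  Num.sqrt (\sum_(i < n) x ord0 i ^+ 2).

Definition is_lipschitz (R : realType) (n : nat) (f : 'rV[R]_n -> 'rV[R]_n) :
    Prop :=
  exists L : R, forall x y, enorm (f x - f y) <= L * enorm (x - y).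

Definition convex_hull (R : realType) (M : lmodType R) (A : set M) : set M :=
  smallest (@convex_set R M) A.

(* [jacobian f x] acts on row vectors ([v *m jacobian f x] is the differential
   of f at x applied to v), hence is the transpose of the matrix acting on
   columns; [eigenvalue] below likewise refers to row eigenvectors. *)
Definition limiting_jacobians (R : realType) (n : nat)
    (f : 'rV[R]_n -> 'rV[R]_n) (x : 'rV[R]_n) : set 'M[R]_n :=
  [set A | exists u : nat -> 'rV[R]_n,
     [/\ u @ \oo --> x,
         forall k, differentiable f (u k) &
         jacobian f (u k) @[k --> \oo] --> A] ].

Definition clarke_diff (R : realType) (n : nat)
    (f : 'rV[R]_n -> 'rV[R]_n) (x : 'rV[R]_n) : set 'M[R]_n :=
  convex_hull (limiting_jacobians f x).

Definition maximal_rank (R : realType) (n : nat) (D : set 'M[R]_n) : Prop :=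
  forall A, D A -> A \in unitmx.

Definition Spec (R : realType) (n : nat) (D : set 'M[R]_n) : set R[i] :=
  [set l | exists2 A, D A & eigenvalue (map_mx (real_complex R) A) l].

Definition spec_inf (R : realType) (n : nat) (f : 'rV[R]_n -> 'rV[R]_n)
    (x0 : 'rV[R]_n) (t : R) : \bar R :=
  ereal_inf [set r | exists x l,
    [/\ closed_ball_ (@enorm R n) x0 t x,
        Spec (clarke_diff f x) l &
        r = ((Normc.normc l) ^+ n)%:E] ].

Definition homeomorphism (T U : topologicalType) (f : T -> U) : Prop :=
  continuous f /\ exists g : U -> T, [/\ cancel f g, cancel g f & continuous g].

(* Main.v *)
Require Import Defs.
From HB Require Import structures.
From mathcomp Require Import all_boot all_order all_algebra.
From mathcomp Require Import all_classical all_reals all_analysis.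
From mathcomp Require Import perm measurable_realfun complex ring lra.

Set Implicit Arguments.
Unset Strict Implicit.
Unset Printing Implicit Defensive.

Import Order.TTheory GRing.Theory Num.Theory.
Import numFieldNormedType.Exports.

Local Open Scope classical_set_scope.
Local Open Scope ring_scope.

(* A local lower bound for [|f y - f z| / |y - z|] in terms of the spectrum of
   the Clarke differential comes from a mean value inequality whose hypothesis
   only concerns differentiability points. Since such points must be met on
   almost every point of suitable segments, it rests on Rademacher's theorem in
   the form: near every line there is a parallel line almost all of whose points
   are differentiability points. This is obtained without measure theory on
   ['rV[R]_n]: the exceptional set is a countable union of sets, each null on
   every line in some coordinate direction, and by Tonelli's theorem integration
   along lines in different directions commutes.

   If all eigenvalues of [A] satisfy [|l|^n >= s] then [|det A| >= s], and for
   bounded [A] the adjugate formula gives [|v A| >= k s |v|] for a constant [k].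
   Separating the convex set [{v A}] from the origin and using the mean value
   inequality, [f] is locally expanding with constant [k s / 2], and minimising
   [|f z - y|] over small balls shows that it is locally onto.

   Finally, segments issued from [f x0] are lifted through [f] by small steps.
   With [M r] the integral of [s] on [[0, r]], the potential [M (|x - x0| + 1)]
   grows along a lift at most proportionally to the length of the segment, so
   that, [M] being unbounded, the lift stays in a ball where the step size is
   uniform. The lifts depend continuously on the end point and provide a
   two-sided inverse of [f]. *)

(** * Lipschitz functions of one real variable *)

Lemma lipschitz_continuous (R : realType) (U W : normedModType R) (h : U -> W)
    (L : R) :
  (forall x y, `|h x - h y| <= L * `|x - y|) -> continuous h.
Proof.
move=> hL x; apply/cvgrPdist_le => e e0.
have L1 : 0 < `|L| + 1 by rewrite ltr_wpDl.
near=> y; apply: (le_trans (hL _ _)).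
apply: (@le_trans _ _ ((`|L| + 1) * `|x - y|)).
  by rewrite ler_wpM2r// (le_trans (ler_norm L))// lerDl.
rewrite mulrC -ler_pdivlMr//; near: y.
by apply: cvgr_dist_le; [exact: cvg_id|exact: divr_gt0].
Unshelve. all: by end_near. Qed.

Section lipschitz_real.
Context {R : realType}.
Implicit Types (h : R -> R) (L : R).
Local Notation mu := (@lebesgue_measure R).

Lemma ae_lebesgueS (P Q : R -> Prop) : (forall x, P x -> Q x) ->
  {ae mu, forall x, P x} -> {ae mu, forall x, Q x}.
Proof. by move=> PQ; apply: negligibleS => x; exact/contra_not/PQ. Qed.

Lemma ae_lebesgueI (P Q : R -> Prop) :
  {ae mu, forall x, P x} -> {ae mu, forall x, Q x} ->
  {ae mu, forall x, P x /\ Q x}.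
Proof.
move=> aeP aeQ; have := negligibleU aeP aeQ; apply: negligibleS => x /=.
by move=> /not_andP.
Qed.

Lemma lebesgue_stieltjes_measure_ocitv (g : cumulative R R) (a b : R) :
  a <= b -> lebesgue_stieltjes_measure g `]a, b] = (g b - g a)%:E.
Proof.
move=> ab; rewrite /lebesgue_stieltjes_measure /measure_extension/=.
by rewrite measurable_mu_extE/= ?wlength_itv_bnd ?EFinB//; exact: is_ocitv.
Qed.

Lemma integrable_cst_ocitv (a b c : R) : mu.-integrable `]a, b] (EFin \o cst c).
Proof.
have mab : measurable (`]a, b] : set (measurableTypeR R)) by exact:
  measurable_itv.
apply/integrableP; split; first exact/measurable_EFinP/measurable_cst.
rewrite -[X in (\int[mu]_(x in _) X x)%E]/(cst `|c|%:E) integral_cst//.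
rewrite [X in (_ * X)%E]lebesgue_measure_itv/=; case: ifP => _.
  by rewrite -EFinB -EFinM ltry.
by rewrite mule0 ltry.
Qed.

(* Both [g] and [C t - g t] being cumulative, their Stieltjes measures add up
   to [C] times the Lebesgue measure. *)
Lemma stieltjes_dominated (g : cumulative R R) (C : R) :
  (forall x y, x <= y -> g y - g x <= C * (y - x)) ->
  lebesgue_stieltjes_measure g `<< mu.
Proof.
move=> gC.
have C0 : 0 <= C.
  have := gC 0 1 ler01; rewrite subr0 mulr1; apply: le_trans.
  by rewrite subr_ge0 (cumulative_is_nondecreasing g).
pose k x := C * x - g x.
have knd : nondecreasing k.
  by move=> x y xy; have := gC _ _ xy; rewrite /k; lra.
have krc : right_continuous k.
  move=> x; apply: cvgB; last exact: (cumulative_is_right_continuous g).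
  by apply: cvg_within_filter; apply: cvgMr; exact: cvg_id.
pose K : cumulative R R := HB.pack k (isCumulative.Build R _ R k knd krc).
pose c x : R := C * x.
have cnd : nondecreasing c by move=> x y xy; rewrite /c ler_wpM2l.
have crc : right_continuous c.
  by move=> x; apply: cvg_within_filter; apply: cvgMr; exact: cvg_id.
pose Cc : cumulative R R := HB.pack c (isCumulative.Build R _ R c cnd crc).
pose m1 := measure_add (lebesgue_stieltjes_measure g)
  (lebesgue_stieltjes_measure K).
have m1D A : m1 A = (lebesgue_stieltjes_measure g A +
  lebesgue_stieltjes_measure K A)%E by exact: measure_addE.
pose m2 := mscale (NngNum C0) mu.
have m1E A : measurable A -> lebesgue_stieltjes_measure Cc A = m1 A.
  apply: lebesgue_stieltjes_measure_unique => X [[a b] _ /= <-].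
  rewrite [RHS]m1D; have [ab|ba] := leP a b.
    rewrite !lebesgue_stieltjes_measure_ocitv//= -EFinD; congr EFin.
    by rewrite /c /k; lra.
  by rewrite set_itv_ge ?bnd_simp -?leNgt ?ltW// !measure0 adde0.
have m2E A : measurable A -> lebesgue_stieltjes_measure Cc A = m2 A.
  apply: lebesgue_stieltjes_measure_unique => X [[a b] _ /= <-].
  rewrite /m2 /mscale /=; have [ab|ba] := leP a b.
    have -> : mu `]a, b] = (b - a)%:E := lebesgue_stieltjes_measure_ocitv idfun
      ab.
    by rewrite lebesgue_stieltjes_measure_ocitv//= -EFinM /c mulrBr.
  by rewrite set_itv_ge ?bnd_simp -?leNgt ?ltW// !measure0 mule0.
apply/null_content_dominatesP => A mA A0.
have : m1 A = 0%E by rewrite -m1E// m2E// /m2 /mscale/= [X in (_ * X)%E]A0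
  mule0.
rewrite m1D => /eqP; rewrite padde_eq0//.
by move=> /andP[/eqP].
Qed.

Lemma is_derive_affine (F : R -> R) (x l L c : R) :
  is_derive x 1 F l -> is_derive x 1 (fun y => F y - L * y + c) (l - L).
Proof.
move=> FD.
have -> : (fun y => F y - L * y + c) = (F - (L \*: (id : R -> R)) + cst c) by
  [].
by apply: is_derive_eq; rewrite addr0 [L *: _]mulr1.
Qed.

(** Adding [L * x] makes [h] nondecreasing, so that the sum has a Stieltjes measure, dominated by
    the Lebesgue measure. Its Radon-Nikodym density minus [L] is the derivative sought, by Lebesgue
    differentiation of the indefinite integral. *)
Lemma lipschitz_ae_density h L (a b : R) :
  a < b -> (forall x y, `|h x - h y| <= L * `|x - y|) ->
  exists d : R -> R, [/\ mu.-integrable `]a, b] (EFin \o d),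
    {ae mu, forall x, `]a, b[%classic x -> derivable h x 1 /\ 'D_1 h x = d x} &
    h b - h a = \int[mu]_(t in `]a, b]) d t].
Proof.
move=> ab hL.
pose g x := h x + L * x.
have hle x y : x <= y -> `|h y - h x| <= L * (y - x).
  by move=> xy; rewrite (le_trans (hL _ _))// ger0_norm// subr_ge0.
have gnd : nondecreasing g.
  move=> x y xy; have := hle _ _ xy; rewrite ler_norml /g => /andP[]; lra.
have gc : continuous g.
  move=> x; apply: cvgD; first exact: (lipschitz_continuous hL).
  by apply: cvgMr; exact: cvg_id.
have grc : right_continuous g by exact: right_continuousW.
pose G : cumulative R R := HB.pack g (isCumulative.Build R _ R g gnd grc).
have GC x y : x <= y -> G y - G x <= (2 * L) * (y - x).
  move=> xy; have := hle _ _ xy; rewrite ler_norml /= /g => /andP[]; lra.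
have mab : measurable (`]a, b] : set (measurableTypeR R)).
  exact: measurable_itv.
have finab : (lebesgue_stieltjes_measure G `]a, b] < +oo)%E.
  by rewrite lebesgue_stieltjes_measure_ocitv ?ltry// ltW.
pose nu : {finite_measure set (measurableTypeR R) -> \bar R} := mfrestr mab
  finab.
have numu : charge_of_finite_measure nu `<< mu.
  apply/null_content_dominatesP => A mA A0.
  have /null_content_dominatesP domG := stieltjes_dominated GC.
  apply: domG; first exact: measurableI.
  by apply: subset_measure0 A0 => //; exact: measurableI.
pose dn := Radon_Nikodym (charge_of_finite_measure nu) mu.
have dfin x : dn x \is a fin_num by exact: Radon_Nikodym_fin_num.
pose d x := fine (dn x).
have dE : dn = EFin \o d by apply/funext => x; rewrite /= fineK.
have di : mu.-integrable setT (EFin \o d).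
  by rewrite -dE; exact: Radon_Nikodym_integrable.
have dint x : a < x -> x <= b -> \int[mu]_(t in `]a, x]) d t = g x - g a.
  move=> ax xb; rewrite /Rintegral.
  rewrite (_ : (fun t => (d t)%:E) = dn) ?dE//.
  rewrite -[X in (\int[mu]_(t in _) X t)%E]/(EFin \o d) -dE.
  rewrite -Radon_Nikodym_integral//.
  rewrite /charge_of_finite_measure/= /mfrestr /mrestr /=.
  rewrite (_ : _ `&` _ = `]a, x]%classic); last first.
    apply/seteqP; split => t /=; rewrite !in_itv/=; first by case.
    by move=> /andP[at_ tx]; rewrite at_ tx; split => //=; apply: le_trans xb.
  by rewrite lebesgue_stieltjes_measure_ocitv// ltW.
have iS (A : set R) : measurable A -> mu.-integrable A (EFin \o d).
  by move=> mA; apply: integrableS di.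
have dloc : locally_integrable setT d.
  split; first by apply/measurable_EFinP; case/integrableP: di.
    exact: openT.
  move=> K _ cK; have /integrableP[] := iS K (compact_measurable cK).
  by [].
have dae := @FTC1 R d (BRight a) (fun y => iS _ (measurable_itv _)) dloc.
exists (fun x => d x - L); split.
- rewrite (_ : EFin \o _ = (EFin \o d) \- (EFin \o cst L))%E; last first.
    by apply/funext => x /=; rewrite EFinB.
  by apply: integrableB; [exact: measurable_itv|by apply: iS; exact:
    measurable_itv|exact: integrable_cst_ocitv].
- apply: ae_lebesgueS dae.
  move=> x /= H; rewrite in_itv/= => /andP[ax xb].
  have [| F1 F2] := H; first exact: ax.
  set F := (fun y => _) in F1 F2.
  (* Near [x], the function [h] differs from the indefinite integral [F] of [d] by an affine
     function, and so inherits its derivability. *)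
  have gF : \forall y \near x, h y = F y - L * y + g a.
    near=> y; rewrite /F dint /g; first lra.
      by near: y; exact: lt_nbhsr.
    by near: y; apply: filterS (lt_nbhsl xb) => ? /ltW.
  have Fd : is_derive x 1 (fun y => F y - L * y + g a) (d x - L).
    have FD : is_derive x 1 F (d x).
      by split => //; rewrite -F2 derive1E.
    exact: is_derive_affine.
  have hd : is_derive x 1 h (d x - L).
    apply: near_eq_is_derive Fd.
    by apply: filterS gF => y ->.
  by split; [exact: ex_derive|exact: derive_val].
- rewrite RintegralB; [|exact: measurable_itv|by apply: iS; exact:
  measurable_itv|exact: integrable_cst_ocitv].
  rewrite dint// Rintegral_cst; last exact: measurable_itv.
  have muab : fine (mu `]a, b]) = b - a.
    exact: (congr1 fine (lebesgue_stieltjes_measure_ocitv idfun (ltW ab))).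
  by rewrite [fine _]muab /g; lra.
Unshelve. all: by end_near. Qed.

Lemma lipschitz_ae_derivable h L :
  (forall x y, `|h x - h y| <= L * `|x - y|) ->
  {ae mu, forall x, derivable h x 1}.
Proof.
move=> hL.
have H (k : nat) : {ae mu, forall x,
    `]- k.+1%:R, k.+1%:R[%classic x -> derivable h x 1}.
  have k0 : - k.+1%:R < k.+1%:R :> R by rewrite gtrN// ltr0n.
  have [d [_ + _]] := lipschitz_ae_density k0 hL.
  by apply: ae_lebesgueS => x dx /dx[].
have /ae_foralln := H.
apply: ae_lebesgueS => x /(_ (Num.truncn `|x|)); apply => /=; rewrite in_itv/=.
by rewrite -ltr_norml truncnS_gt.
Qed.

Lemma lipschitz_increment_ge h L (c : R) :
  (forall x y, `|h x - h y| <= L * `|x - y|) ->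
  {ae mu, forall x, `]0, 1[%classic x -> derivable h x 1 -> c <= 'D_1 h x} ->
  c <= h 1 - h 0.
Proof.
move=> hL hc.
have [d [di dae ->]] := lipschitz_ae_density ltr01 hL.
have mu01 : mu `]0, 1] = 1%E.
  have := lebesgue_stieltjes_measure_ocitv (@idfun R) (@ler01 R).
  by rewrite subr0.
have m01 : measurable (`]0, 1] : set (measurableTypeR R)) by exact:
  measurable_itv.
have ic := integrable_cst_ocitv 0 1 c.
have cE : c = \int[mu]_(t in `]0, 1]) cst c t.
  rewrite Rintegral_cst//; have muab : fine (mu `]0, 1]) = 1 by rewrite mu01.
  by rewrite [fine _]muab mulr1.
rewrite -subr_ge0 {1}cE -RintegralB//.
have idc : mu.-integrable `]0, 1] (EFin \o (fun x => d x - c)).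
  exact: (integrableB m01 di ic).
have in_ : mu.-integrable `]0, 1] (EFin \o (fun x => `|d x - c|)).
  exact: integrable_norm idc.
(* The integrand is almost everywhere nonnegative, so it may be replaced by its absolute value. The
   end point [1], outside the open interval of the hypothesis, is discarded as a null set. *)
rewrite (_ : Rintegral _ _ _ = \int[mu]_(t in `]0, 1]) `|d t - c|).
  by apply: Rintegral_ge0 => //.
rewrite /Rintegral; congr fine; apply: ae_eq_integral => //.
- by case/integrableP: idc.
- by case/integrableP: in_.
have n1 : {ae mu, forall x, x <> 1}.
  exists [set 1]; split; [exact: measurable_set1|exact: lebesgue_measure_set1|].
  by move=> x /= /contrapT.
apply: ae_lebesgueS (ae_lebesgueI (ae_lebesgueI hc dae) n1).
move=> x [[hcx dx] x1] /=; rewrite in_itv/= => /andP[x0 x1'].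
have x01 : `]0, 1[%classic x.
  by rewrite /= in_itv/= x0 lt_neqAle x1' andbT; exact/eqP.
have [dh <-] := dx x01; rewrite ger0_norm// subr_ge0; exact: hcx.
Qed.

End lipschitz_real.

(** * Iterated integrals along lines, and generic parallel lines *)

Section line_integrals.
Context {R : realType} {n : nat}.
Local Notation V := 'rV[R]_n.
Local Notation mu := (@lebesgue_measure R).

(* Measurability with respect to the sigma-algebra generated by the coordinates
   of ['rV[R]_n], expressed through all maps with measurable coordinates so
   that no measurable structure on ['rV[R]_n] is needed. *)
Definition coord_measurable (N : set V) :=
  forall (d : measure_display) (T : measurableType d) (u : T -> V),
  (forall i, measurable_fun setT (fun t => u t ord0 i)) ->
  measurable (u @^-1` N).

Definition coord_measurable_fun (phi : V -> \bar R) :=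
  forall (d : measure_display) (T : measurableType d) (u : T -> V),
  (forall i, measurable_fun setT (fun t => u t ord0 i)) ->
  measurable_fun setT (phi \o u).

Definition line_integral (v : V) (phi : V -> \bar R) (x : V) : \bar R :=
  (\int[mu]_t phi (x + t *: v)%R)%E.

Definition iter_line_integral (vs : seq V) (phi : V -> \bar R) :=
  foldr line_integral phi vs.

Let line2_measurable d (T : measurableType d) (u : T -> V) (v : V) :
  (forall i, measurable_fun setT (fun t => u t ord0 i)) ->
  forall i, measurable_fun setT
    (fun p : T * measurableTypeR R => (u p.1 + p.2 *: v) ord0 i).
Proof.
move=> mu_ i; under eq_fun do rewrite !mxE.
apply: measurable_funD.
  exact: (measurableT_comp (mu_ i) measurable_fst).
by apply: measurable_funM => //; exact: measurable_snd.
Qed.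

Lemma line_measurable (x v : V) (i : 'I_n) :
  measurable_fun setT (fun t : measurableTypeR R => (x + t *: v) ord0 i).
Proof.
under eq_fun do rewrite !mxE.
by apply: measurable_funD => //; apply: measurable_funM.
Qed.

Lemma line_integral_ge0 v phi : (forall x, 0 <= phi x)%E ->
  forall x, (0 <= line_integral v phi x)%E.
Proof. by move=> phi0 x; exact: integral_ge0. Qed.

Lemma line_integral_measurable v phi : (forall x, 0 <= phi x)%E ->
  coord_measurable_fun phi -> coord_measurable_fun (line_integral v phi).
Proof.
move=> phi0 mphi d T u mu_.
pose F (p : T * measurableTypeR R) := phi (u p.1 + p.2 *: v).
have mF : measurable_fun setT F by apply: mphi; exact: line2_measurable.
by have := @measurable_fun_fubini_tonelli_F _ _ _ _ R mu F mF (fun=> phi0 _).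
Qed.

(** Tonelli's theorem for the function [F] of the two translation parameters. *)
Lemma line_integralC v w phi : (forall x, 0 <= phi x)%E ->
  coord_measurable_fun phi ->
  line_integral v (line_integral w phi) = line_integral w (line_integral v phi).
Proof.
move=> phi0 mphi; apply/funext => x; rewrite /line_integral.
pose F (p : measurableTypeR R * measurableTypeR R) := phi (x + p.1 *: v + p.2 *:
  w).
have mF : measurable_fun setT F.
  apply: mphi; apply: (@line2_measurable _ (measurableTypeR R)
    (fun t => x + t *: v) w).
  exact: line_measurable.
rewrite (@fubini_tonelli _ _ _ _ R mu mu F mF (fun=> phi0 _)).
by apply: eq_integral => t _; apply: eq_integral => s _; rewrite /F/= addrAC.
Qed.

Lemma iter_line_integral_ge0 vs phi : (forall x, 0 <= phi x)%E ->
  forall x, (0 <= iter_line_integral vs phi x)%E.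
Proof. by move=> phi0; elim: vs => //= v vs ih; exact: line_integral_ge0. Qed.

Lemma iter_line_integral_measurable vs phi : (forall x, 0 <= phi x)%E ->
  coord_measurable_fun phi -> coord_measurable_fun (iter_line_integral vs phi).
Proof.
move=> phi0 mphi; elim: vs => //= v vs ih; apply: line_integral_measurable =>
  //.
exact: iter_line_integral_ge0.
Qed.

Lemma iter_line_integralC vs v phi : (forall x, 0 <= phi x)%E ->
  coord_measurable_fun phi ->
  iter_line_integral vs (line_integral v phi) =
  line_integral v (iter_line_integral vs phi).
Proof.
move=> phi0 mphi; elim: vs => //= w vs ->; rewrite line_integralC//.
- exact: iter_line_integral_ge0.
- exact: iter_line_integral_measurable.
Qed.

Lemma line_integral0 v : line_integral v (cst 0%E) = cst 0%E.
Proof. by apply/funext => x; rewrite /line_integral integral0. Qed.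

Lemma iter_line_integral0 vs : iter_line_integral vs (cst 0%E) = cst 0%E.
Proof. by elim: vs => //= v vs ->; exact: line_integral0. Qed.

(** Integrals along lines commute, so the one along [v] can be performed first, on [phi] itself. *)
Lemma iter_line_integral_eq0 vs v phi : (forall x, 0 <= phi x)%E ->
  coord_measurable_fun phi -> v \in vs -> line_integral v phi = cst 0%E ->
  iter_line_integral vs phi = cst 0%E.
Proof.
move=> phi0 mphi + v0; elim: vs => //= w vs ih; rewrite inE => /orP[/eqP <-|/ih
  ->].
  by rewrite -iter_line_integralC// v0 iter_line_integral0.
exact: line_integral0.
Qed.

Lemma line_integral_eq0_ae v phi x : (forall x, 0 <= phi x)%E ->
  coord_measurable_fun phi -> line_integral v phi x = 0%E ->
  {ae mu, forall t, phi (x + t *: v) = 0%E}.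
Proof.
move=> phi0 mphi; rewrite /line_integral => i0.
have mF : measurable_fun setT (fun t : measurableTypeR R => phi (x + t *: v)).
  by apply: mphi; exact: line_measurable.
have /(ae_eq_integral_abs mu measurableT mF) : (\int[mu]_t `|phi (x + t *:
  v)%R|)%E = 0%E.
  by rewrite -i0; apply: eq_integral => t _; rewrite gee0_abs.
by apply: ae_lebesgueS => t; exact.
Qed.

Lemma ae_exists_small (P : R -> Prop) (e : R) : 0 < e ->
  {ae mu, forall t, P t} -> exists2 t, 0 <= t <= e & P t.
Proof.
move=> e0 [A [mA A0 PA]]; apply: contrapT => /forall2NP noP.
have : (mu `]0%R, e] <= mu A)%E.
  apply: le_measure; [by apply/mem_set; exact: measurable_itv|exact/mem_set|].
  move=> t /=; rewrite in_itv/= => /andP[t0 te]; apply: PA => /= Pt.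
  by have [] := noP t => //; rewrite (ltW t0) te.
rewrite A0 [X in (X <= _)%E](lebesgue_stieltjes_measure_ocitv idfun (ltW e0)).
by rewrite subr0 lee_fin leNgt e0.
Qed.

(** One direction is removed at a time: a vanishing outer integral leaves the inner ones zero at
    almost every translate, for the countably many [j] at once, and such translates exist
    arbitrarily close to [x]. *)
Lemma iter_line_integral_eq0_near vs (phi : nat -> V -> \bar R) x e :
  0 < e -> (forall j y, 0 <= phi j y)%E ->
  (forall j, coord_measurable_fun (phi j)) ->
  (forall j, iter_line_integral vs (phi j) x = 0%E) ->
  exists2 y, `|x - y| <= e & forall j, phi j y = 0%E.
Proof.
move=> + phi0 mphi; elim: vs x e => /= [x e e0 H|v vs ih x e e0 H].
  by exists x => //; rewrite subrr normr0 ltW.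
have /ae_foralln ae0 : forall j, {ae mu, forall t,
    iter_line_integral vs (phi j) (x + t *: v) = 0%E}.
  move=> j; apply: line_integral_eq0_ae => //; first exact:
    iter_line_integral_ge0.
  exact: iter_line_integral_measurable.
have v1 : 0 < `|v| + 1 by rewrite ltr_wpDl.
(* Half of [e] is spent on the translation along [v], the other half on the remaining directions. *)
have e'0 : 0 < e / 2 / (`|v| + 1) by rewrite !divr_gt0.
have [t /andP[t0 te] tP] := ae_exists_small e'0 ae0.
have [y xy yP] := ih _ _ (divr_gt0 e0 (ltr0n R 2)) tP.
exists y => //; have -> : x - y = (x + t *: v - y) - t *: v.
  by rewrite addrAC addrK.
rewrite (le_trans (ler_normB _ _))// (splitr e) lerD// normrZ ger0_norm//.
rewrite (@le_trans _ _ (t * (`|v| + 1)))//; first by rewrite ler_wpM2l// lerDl.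
by rewrite -ler_pdivlMr.
Qed.

Lemma indic_measurable N : coord_measurable N ->
  coord_measurable_fun (fun x => (\1_N x)%:E).
Proof.
move=> mN d T u mu_; apply/measurable_EFinP.
have : measurable_fun setT (\1_(u @^-1` N) : T -> R).
  by apply: measurable_indic; exact: mN.
by apply: eq_measurable_fun => t _; rewrite !indicE.
Qed.

Lemma line_integral_indic N v x : coord_measurable N ->
  line_integral v (fun x => (\1_N x)%:E) x = mu [set t | N (x + t *: v)].
Proof.
move=> mN; rewrite /line_integral.
have mA : measurable ([set t | N (x + t *: v)] : set (measurableTypeR R)).
  by apply: mN; exact: line_measurable.
have := @integral_indic _ _ R mu setT measurableT _ mA; rewrite setIT => <-.
by apply: eq_integral => t _; rewrite !indicE.
Qed.

(* Averaging over the translations spanned by the coordinate directions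
   commutes with integration along [v], and kills every [N j]. *)
Lemma generic_line_avoids (N : nat -> set V) (vs : seq V) (x v : V) (e : R) :
  0 < e -> (forall j, coord_measurable (N j)) ->
  (forall j, exists2 w, w \in vs & forall y, mu [set t | N j (y + t *: w)] =
    0%E) ->
  exists2 y, `|x - y| <= e & {ae mu, forall t j, ~ N j (y + t *: v)}.
Proof.
move=> e0 mN N0.
pose phi j := line_integral v (fun x => (\1_(N j) x)%:E).
have i0 j z : (0 <= (\1_(N j) z)%:E :> \bar R)%E by rewrite lee_fin.
have mi j := indic_measurable (mN j).
have phi0 j y : (0 <= phi j y)%E by exact: line_integral_ge0.
have mphi j : coord_measurable_fun (phi j) by exact: line_integral_measurable.
have [|y xy yP] := @iter_line_integral_eq0_near vs phi x e e0 phi0 mphi.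
  move=> j; have [w wvs wN] := N0 j.
  rewrite /phi iter_line_integralC; [|by move=> z; exact: i0|exact: mi].
  have -> : iter_line_integral vs (fun x => (\1_(N j) x)%:E) = cst 0%E.
    apply: (iter_line_integral_eq0 _ _ wvs); [by move=> z; exact: i0|exact:
      mi|].
    by apply/funext => z; rewrite line_integral_indic; [exact: wN|exact: mN].
  by rewrite line_integral0.
exists y => //; apply: ae_foralln => j.
have := yP j; rewrite /phi line_integral_indic; last exact: mN.
move=> y0.
exists [set t | N j (y + t *: v)]; split => //; last by move=> t /= /contrapT.
by apply: mN; exact: line_measurable.
Qed.

End line_integrals.

(** * Entries and sup norm; measurability of open and closed sets *)

Section matrix_norm.
Context {R : realType} {m n : nat}.
Implicit Types x y : 'M[R]_(m, n).

Lemma mx_entry_le_norm x i j : `|x i j| <= `|x|.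
Proof.
by rewrite [leRHS]mx_normrE (le_bigmax _ (fun ij => `|x ij.1 ij.2|) (i, j)).
Qed.

Lemma mx_norm_le x (c : R) : 0 <= c -> (forall i j, `|x i j| <= c) -> `|x| <= c.
Proof. by move=> c0 xc; rewrite [leLHS]mx_normrE; apply: bigmax_le => // -[i j]
  _. Qed.

Lemma mx_norm_lt x (c : R) : 0 < c -> (forall i j, `|x i j| < c) -> `|x| < c.
Proof. by move=> c0 xc; rewrite [ltLHS]mx_normrE; apply: bigmax_lt => // -[i j]
  _. Qed.

End matrix_norm.

Section coord_measurable_sets.
Context {R : realType} {n : nat}.
Local Notation V := 'rV[R]_n.
Local Notation mu := (@lebesgue_measure R).

Lemma coord_measurableC (N : set V) : coord_measurable N -> coord_measurable (~`
  N).
Proof. by move=> mN d T u mu_; rewrite preimage_setC; apply: measurableC; exact: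
  mN. Qed.

Lemma coord_measurable_bigcup (N : nat -> set V) :
  (forall i, coord_measurable (N i)) -> coord_measurable (\bigcup_i N i).
Proof.
move=> mN d T u mu_; rewrite preimage_bigcup; apply: bigcupT_measurable => i.
exact: mN.
Qed.

Lemma coord_measurable_bigcap (N : nat -> set V) :
  (forall i, coord_measurable (N i)) -> coord_measurable (\bigcap_i N i).
Proof.
move=> mN d T u mu_; rewrite preimage_bigcap; apply: bigcapT_measurable => i.
exact: mN.
Qed.

Lemma rat_approx (x e : R) : 0 < e -> exists q : rat, `|x - ratr q| < e.
Proof.
move=> e0; have [|q] := @rat_in_itvoo R (x - e) (x + e); first by lra.
rewrite in_itv/= => /andP[q1 q2]; exists q.
by rewrite ltr_norml; apply/andP; split; lra.
Qed.

Lemma rat_approx_mx (x : V) (e : R) : 0 < e ->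
  exists q : 'rV[rat]_n, forall i, `|x ord0 i - ratr (q ord0 i)| < e.
Proof.
move=> e0; have [q qP] := choice (fun i => rat_approx (x ord0 i) e0).
by exists (\row_i q i) => i; rewrite mxE.
Qed.

(** An open set is the union of the countably many rational boxes it contains, and membership in a
    box is a finite conjunction of conditions on coordinates. *)
Lemma open_coord_measurable (U : set V) : open U -> coord_measurable U.
Proof.
move=> oU d T u mu_.
pose box (k : 'rV[rat]_n * nat) : set V :=
  [set x | forall i, `|x ord0 i - ratr (k.1 ord0 i)| < k.2.+1%:R^-1].
pose A k : set T := [set t | box k `<=` U /\ box k (u t)].
have -> : u @^-1` U = \bigcup_k A k.
  apply/seteqP; split => t /=; last by move=> [k _ [kU]]; apply: kU.
  rewrite openE in oU => /oU /nbhs_ballP[e /= e0 eU].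
  have [k ke] : exists k : nat, k.+1%:R^-1 < e / 2.
    have e2 : 0 < e / 2 by rewrite divr_gt0.
    have := near_infty_natSinv_lt (PosNum e2) => -[k _ kP].
    by exists k; exact: (kP k (leqnn k)).
  have k0 : 0 < k.+1%:R^-1 :> R by rewrite invr_gt0.
  have [q qP] := rat_approx_mx (u t) k0.
  exists (q, k) => //; split => // y /= yq; apply: eU.
  rewrite mx_norm_ball /ball_ /=; apply: mx_norm_lt => // i j.
  rewrite (ord1 i) !mxE; move: ke (qP j) (yq j) => /=; move: (_^-1) => c ce.
  by rewrite !ltr_norml => /andP[? ?] /andP[? ?]; apply/andP; split; lra.
apply: countable_bigcupT_measurable; first exact: countableP.
move=> k; rewrite /A; have [kU|kU] := pselect (box k `<=` U); last first.
  rewrite (_ : mkset _ = set0); first exact: measurable0.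
  by apply/seteqP; split => // t [].
rewrite (_ : mkset _ = \bigcap_(i in [set: 'I_n])
   [set t | `|u t ord0 i - ratr (k.1 ord0 i)| < k.2.+1%:R^-1]); last first.
  by apply/seteqP; split => t /= => [[_ bt] i _|bt]; [exact: bt|split => // i;
    exact: bt].
apply: fin_bigcap_measurable; first exact: finite_finset.
move=> i _.
have mf : measurable_fun setT (fun t => `|u t ord0 i - ratr (k.1 ord0 i)|).
  by apply: measurableT_comp => //; apply: measurable_funB.
by have := mf measurableT _ (measurable_itv `]-oo, k.2.+1%:R^-1[); rewrite
  setTI.
Qed.

Lemma closed_coord_measurable (F : set V) : closed F -> coord_measurable F.
Proof.
move=> cF; rewrite -(setCK F); apply: coord_measurableC.
by apply: open_coord_measurable; exact: closed_openC.
Qed.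

End coord_measurable_sets.

(** * Directional derivability on generic lines *)

Section directional_derivability.
Context {R : realType} {n : nat}.
Local Notation V := 'rV[R]_n.
Local Notation mu := (@lebesgue_measure R).
Implicit Types (g : V -> R) (x w : V).

Lemma natSinv_small (e : R) : 0 < e -> exists k : nat, k.+1%:R^-1 < e.
Proof.
move=> e0; have [k _ kP] := near_infty_natSinv_lt (PosNum e0).
by exists k; exact: (kP k (leqnn k)).
Qed.

Definition diff_quotient g w (s : R) x : R := s^-1 * (g (s *: w + x) - g x).

Lemma derivable_approx g x w : derivable g x w ->
  exists b : R, forall e : R, 0 < e -> exists2 d : R, 0 < d &
    forall s : R, `|s| < d -> `|g (x + s *: w) - g x - s * b| <= e * `|s|.
Proof.
move=> /cvg_ex[b /= bP]; exists b => e e0.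
have /cvgrPdist_le /(_ _ e0) [d /= d0 dP] := bP.
exists d => // s sd; have [->|s0] := eqVneq s 0.
  by rewrite scale0r addr0 subrr mul0r subr0 normr0 mulr0.
have := dP s; rewrite /ball/= sub0r normrN => /(_ sd s0).
rewrite /shift/= [_ *: (_ - _)]/(_ * _) [s *: w + x]addrC.
set D := g _ - g x => H.
have -> : D - s * b = - s * (b - s^-1 * D).
  by rewrite mulrBr mulNr mulNr mulrA mulfV// mul1r opprK addrC.
by rewrite normrM normrN mulrC ler_wpM2r.
Qed.

(** The Cauchy form avoids the unknown limit and leaves only the countable quantifiers over [p] and
    [q] outside closed conditions, which is the shape that measurability requires. *)
Lemma derivable_cauchyP g x w : derivable g x w <->
  forall p : nat, exists q : nat, forall s s' : R, s != 0 -> s' != 0 ->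
    `|s| < q.+1%:R^-1 -> `|s'| < q.+1%:R^-1 ->
    `|diff_quotient g w s x - diff_quotient g w s' x| <= p.+1%:R^-1.
Proof.
split=> [/derivable_approx[b bP] p|H].
  have p0 : 0 < p.+1%:R^-1 / 2 :> R by rewrite divr_gt0.
  have [d d0 dP] := bP _ p0; have [q qd] := natSinv_small d0.
  exists q => s s' s0 s'0 sq s'q.
  have E t : t != 0 -> `|t| < q.+1%:R^-1 ->
      `|diff_quotient g w t x - b| <= p.+1%:R^-1 / 2.
    move=> t0 tq; rewrite /diff_quotient [t *: w + x]addrC.
    have := dP t (lt_trans tq qd); set D := g _ - g x => H.
    have -> : t^-1 * D - b = t^-1 * (D - t * b) by rewrite [RHS]mulrBr mulKf.
    by rewrite normrM normfV ler_pdivrMl ?normr_gt0// [leRHS]mulrC.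
  have := E s s0 sq; have := E s' s'0 s'q; move: (_ / 2) (splitr (p.+1%:R^-1 :
    R)).
  by move=> c ->; rewrite !ler_norml => /andP[? ?] /andP[? ?]; apply/andP;
    split; lra.
apply: cauchy_cvg; apply: cauchy_exP => e e0.
have [p pe] := natSinv_small e0; have [q qP] := H p.
have q0 : 0 < q.+1%:R^-1 :> R by rewrite invr_gt0.
pose s0 : R := q.+1%:R^-1 / 2.
have s00 : 0 < s0 by rewrite divr_gt0.
exists (diff_quotient g w s0 x).
suff : \forall s \near 0^',
  `|diff_quotient g w s0 x - diff_quotient g w s x| < e by [].
near=> s; apply: (le_lt_trans _ pe); apply: qP.
- exact: lt0r_neq0.
- by near: s; exact: nbhs_dnbhs_neq.
- by rewrite gtr0_norm// ltr_pdivrMr// ltr_pMr// ltr1n.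
- by near: s; exact: dnbhs0_lt.
Unshelve. all: by end_near. Qed.

(* For fixed tolerances the Cauchy condition on difference quotients defines a
   closed set, since it is an intersection over all step sizes. *)
Lemma derivable_measurable g (L : R) w :
  (forall x y, `|g x - g y| <= L * `|x - y|) ->
  coord_measurable [set x | ~ derivable g x w].
Proof.
move=> gL.
pose C (p q : nat) : set V := \bigcap_(s in [set s : R | s != 0 /\ `|s| <
  q.+1%:R^-1])
  \bigcap_(s' in [set s : R | s != 0 /\ `|s| < q.+1%:R^-1])
    [set x | `|diff_quotient g w s x - diff_quotient g w s' x| <= p.+1%:R^-1].
have -> : [set x | ~ derivable g x w] = ~` \bigcap_p \bigcup_q C p q.
  congr setC; apply/seteqP; split => x.
    move=> /derivable_cauchyP H p _; have [q qP] := H p; exists q => //.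
    by move=> s [s0 sq] s' [s'0 s'q]; exact: qP.
  move=> H; apply/derivable_cauchyP => p; have [q _ qP] := H p Logic.I.
  by exists q => s s' s0 s'0 sq s'q; apply: qP.
apply: coord_measurableC; apply: coord_measurable_bigcap => p.
apply: coord_measurable_bigcup => q; apply: closed_coord_measurable.
have QL s x y : `|diff_quotient g w s x - diff_quotient g w s y| <=
    (`|s^-1| * (L + L)) * `|x - y|.
  rewrite /diff_quotient -mulrBr normrM -mulrA ler_wpM2l//.
  have -> : g (s *: w + x) - g x - (g (s *: w + y) - g y) =
    (g (s *: w + x) - g (s *: w + y)) - (g x - g y) by ring.
  rewrite (le_trans (ler_normB _ _))// mulrDl lerD//.
  by rewrite (le_trans (gL _ _))// opprD addrACA subrr add0r.
apply: closed_bigI => s _; apply: closed_bigI => s' _.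
pose h x := `|diff_quotient g w s x - diff_quotient g w s' x|.
apply: (@preimage_closed _ _ h [set r : R | r <= p.+1%:R^-1]); last exact:
  closed_le.
move=> x _; apply: (@lipschitz_continuous _ _ _ h (`|s^-1| * (L + L) + `|s'^-1|
  * (L + L))).
move=> y z; rewrite /h (le_trans (ler_dist_dist _ _))//.
have -> : diff_quotient g w s y - diff_quotient g w s' y -
  (diff_quotient g w s z - diff_quotient g w s' z) =
  (diff_quotient g w s y - diff_quotient g w s z) -
  (diff_quotient g w s' y - diff_quotient g w s' z) by ring.
by rewrite (le_trans (ler_normB _ _))// mulrDl lerD.
Qed.

Lemma lipschitz_line g (L : R) x w :
  (forall x y, `|g x - g y| <= L * `|x - y|) ->
  forall s t, `|g (x + s *: w) - g (x + t *: w)| <= (L * `|w|) * `|s - t|.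
Proof.
move=> gL s t; apply: (le_trans (gL _ _)).
have -> : x + s *: w - (x + t *: w) = (s - t) *: w.
  by rewrite opprD addrACA subrr add0r scalerBl.
by rewrite normrZ mulrA (mulrAC L).
Qed.

Lemma derivable_line g x w (t : R) :
  derivable (fun s : R => g (x + s *: w)) t 1 <-> derivable g (x + t *: w) w.
Proof.
rewrite /derivable; set F := (fun h => _); set G := (fun h => _).
suff -> : F = G by [].
apply/funext => h; rewrite /F /G /shift/=; congr (_ *: (g _ - _)).
by rewrite [h *: 1]mulr1 scalerDl addrCA.
Qed.

(** On a line in direction [w], derivability along [w] is derivability of a Lipschitz function of
    one variable. *)
Lemma lipschitz_line_null g (L : R) x w :
  (forall x y, `|g x - g y| <= L * `|x - y|) ->
  mu [set t | ~ derivable g (x + t *: w) w] = 0%E.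
Proof.
move=> gL; apply/negligibleP.
  apply: (derivable_measurable w gL) => i.
  exact: line_measurable.
have := lipschitz_ae_derivable (lipschitz_line x w gL).
by apply: ae_lebesgueS => t /derivable_line.
Qed.

Lemma generic_line_derivable (I : countType) (g : I -> V -> R) (L : I -> R)
    (w : I -> V) (vs : seq V) (x v : V) (e : R) :
  (forall i x y, `|g i x - g i y| <= L i * `|x - y|) ->
  (forall i, w i \in vs) -> 0 < e ->
  exists2 y, `|x - y| <= e &
    {ae mu, forall t i, derivable (g i) (y + t *: v) (w i)}.
Proof.
move=> gL wvs e0.
(* The family is numbered by [pickle]. Numbers that decode to nothing receive the empty set, and the
   direction [0] is added to [vs] to serve them. *)
pose N j := if unpickle j is Some i then [set x | ~ derivable (g i) x (w i)]
  else set0.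
have [||y xy yP] := @generic_line_avoids R n N (0 :: vs) x v e e0.
- rewrite /N => j; case: unpickle => [i|].
    exact: derivable_measurable (gL i).
  by move=> d T u _; rewrite preimage_set0; exact: measurable0.
- rewrite /N => j; case: unpickle => [i|].
    exists (w i); first by rewrite inE wvs orbT.
    by move=> y; exact: lipschitz_line_null (gL i).
  exists 0; first by rewrite inE eqxx.
  by move=> y; rewrite (_ : mkset _ = set0) ?measure0.
exists y => //; apply: ae_lebesgueS yP => t tN i.
by have := tN (pickle i); rewrite /N pickleK => /contrapT.
Qed.

End directional_derivability.

(** * Rademacher's theorem by means of distance functions *)

Section rademacher.
Context {R : realType} {n : nat}.
Local Notation V := 'rV[R]_n.
Local Notation mu := (@lebesgue_measure R).
Implicit Types (g : V -> R) (E : set V) (x y z a : V).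

Definition set_dist E x : R := inf [set `|x - z| | z in E].

Lemma set_dist_has_inf E x z : E z -> has_inf [set `|x - z| | z in E].
Proof.
move=> Ez; split; first by exists `|x - z|; exists z.
by exists 0 => _ [u _ <-].
Qed.

Lemma set_dist_le E x z : E z -> set_dist E x <= `|x - z|.
Proof.
by move=> Ez; apply: ge_inf; [have [] := set_dist_has_inf x Ez|exists z].
Qed.

(** The default value of [inf] keeps the distance function Lipschitz even for the empty set. *)
Lemma set_dist_empty E x : ~ (E !=set0) -> set_dist E x = 0.
Proof.
move=> E0; have -> : E = set0.
  by apply/seteqP; split => // z Ez; case: E0; exists z.
by rewrite /set_dist image_set0 inf0.
Qed.

Lemma set_dist_ge0 E x : 0 <= set_dist E x.
Proof.
have [[z Ez]|E0] := pselect (E !=set0); last by rewrite set_dist_empty.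
by apply: lb_le_inf => [|_ [u _ <-]//]; exists `|x - z|; exists z.
Qed.

Lemma set_dist_lt E x z (e : R) : E z -> set_dist E x < e ->
  exists2 u, E u & `|x - u| < e.
Proof.
move=> Ez xe; have e0 : 0 < e - set_dist E x by rewrite subr_gt0.
have [r [u Eu <-] ue] := inf_adherent e0 (set_dist_has_inf x Ez).
by exists u => //; move: ue; rewrite [ltRHS]addrC subrK.
Qed.

Lemma set_dist_lipschitz E x y : `|set_dist E x - set_dist E y| <= 1 * `|x - y|.
Proof.
rewrite mul1r.
suff H u v : set_dist E u - set_dist E v <= `|u - v|.
  by rewrite ler_norml lerNl opprB H distrC H.
have [[z Ez]|E0] := pselect (E !=set0); last by rewrite !set_dist_empty// subrr.
rewrite lerBlDr -lerBlDl; apply: lb_le_inf.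
  by exists `|v - z|; exists z.
move=> _ [t Et <-]; rewrite lerBlDl (le_trans (set_dist_le u Et))//.
by rewrite -(subrKA v) ler_normD.
Qed.

Definition dotp (m : nat) (a y : 'rV[R]_m) : R := \sum_i a ord0 i * y ord0 i.

Lemma dotpDl m (a b y : 'rV[R]_m) : dotp (a + b) y = dotp a y + dotp b y.
Proof. by rewrite -big_split/=; apply: eq_bigr => i _; rewrite mxE mulrDl. Qed.

Lemma dotpNl m (a y : 'rV[R]_m) : dotp (- a) y = - dotp a y.
Proof. by rewrite -sumrN/=; apply: eq_bigr => i _; rewrite mxE mulNr. Qed.

Lemma dotpC m (a y : 'rV[R]_m) : dotp a y = dotp y a.
Proof. by apply: eq_bigr => i _; rewrite mulrC. Qed.

Lemma dotpDr m (a y z : 'rV[R]_m) : dotp a (y + z) = dotp a y + dotp a z.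
Proof. by rewrite !(dotpC a) dotpDl. Qed.

Lemma dotp_le m (a y : 'rV[R]_m) (c : R) : 0 <= c ->
  (forall i, `|a ord0 i| <= c) -> `|dotp a y| <= m%:R * c * `|y|.
Proof.
move=> c0 ac; rewrite (le_trans (ler_norm_sum _ _ _))//.
rewrite (@le_trans _ _ (\sum_(i < m) c * `|y|))//.
  by apply: ler_sum => i _; rewrite normrM ler_pM// mx_entry_le_norm.
by rewrite sumr_const card_ord -[leLHS]mulr_natl mulrA.
Qed.

Definition supported_below (k : nat) (y : V) :=
  forall i : 'I_n, (k <= i)%N -> y ord0 i = 0.

(** Only increments in the first [k] coordinates are tested, so that differentiability can be built
    up one coordinate at a time. The scale [d] is a parameter in order to be common to all points
    [z] of the resulting set. *)
Definition linear_approx g (k : nat) a (e d : R) z :=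
  forall y, supported_below k y -> `|y| <= d ->
    `|g (z + y) - g z - dotp a y| <= e * `|y|.

(** A countable family whose derivability in the coordinate directions forces differentiability of
    [g]: besides [g] itself, it contains the distances to the sets where [g] is approximated by a
    given rational form with given tolerance and scale. *)
Definition rademacher_family g (i : 'I_n * option ('rV[rat]_n * nat * nat)) : V
  -> R :=
  if i.2 is Some (a, p, q) then
    set_dist (linear_approx g i.1 (map_mx ratr a) p.+1%:R^-1 q.+1%:R^-1)
  else g.

(* The distance to a set is minimal on the set, so a two-sided derivative there
   must vanish. *)
Lemma set_dist_derivable0 E x w : E x -> derivable (set_dist E) x w ->
  forall e : R, 0 < e -> exists2 d : R, 0 < d &
    forall s : R, `|s| < d -> exists2 z, E z & `|x + s *: w - z| <= e * `|s|.
Proof.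
move=> Ex /derivable_approx[b bP].
have Ex0 : set_dist E x = 0.
  apply/eqP; rewrite eq_le set_dist_ge0 andbT.
  by rewrite (le_trans (set_dist_le x Ex))// subrr normr0.
have bE (e : R) : 0 < e -> `|b| <= e.
  move=> e0; have [d d0 dP] := bP e e0.
  have d2 : 0 < d / 2 by rewrite divr_gt0.
  have d2d : `|d / 2| < d by rewrite gtr0_norm// ltr_pdivrMr// ltr_pMr// ltr1n.
  have := dP _ d2d; have := dP (- (d / 2)); rewrite normrN => /(_ d2d).
  rewrite Ex0 !subr0 (gtr0_norm d2).
  have := set_dist_ge0 E (x + (d / 2) *: w).
  have := set_dist_ge0 E (x + (- (d / 2)) *: w).
  move: (d / 2) d2 (set_dist _ _) (set_dist _ _) => c c0 A B A0 B0.
  rewrite !ler_norml => /andP[h1 h2] /andP[h3 h4].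
  by apply/andP; split; rewrite -(ler_pM2r c0); lra.
have b0 : b = 0.
  apply/eqP; rewrite -normr_le0; apply/ler_addgt0Pr => e e0.
  by rewrite add0r; exact: bE.
move=> e e0; have e2 : 0 < e / 2 by rewrite divr_gt0.
have [d d0 dP] := bP _ e2; exists d => // s sd.
have [->|s0] := eqVneq s 0.
  by exists x => //; rewrite scale0r addr0 subrr !normr0 mulr0.
have := dP s sd; rewrite Ex0 b0 mulr0 !subr0 => H.
have [|z Ez zP] := @set_dist_lt E (x + s *: w) x (e * `|s|) Ex.
  apply: (le_lt_trans (ler_norm _)); apply: (le_lt_trans H).
  by rewrite ltr_pM2r ?normr_gt0// ltr_pdivrMr// ltr_pMr// ltr1n.
by exists z => //; exact: ltW.
Qed.

(** The point [x] lies in the set [E] of points approximated by a fixed rational form at a fixed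
    scale. As the distance to [E] is derivable along coordinate [k], a move of length [s] along it
    ends within [o(s)] of a point of [E], where the same form approximates [g]. The partial
    derivative [b] supplies the new coefficient. *)
Lemma linear_approx_step g (L : R) (k : 'I_n) x :
  (forall x y, `|g x - g y| <= L * `|x - y|) ->
  (forall o, derivable (rademacher_family g (k, o)) x (delta_mx ord0 k)) ->
  (exists a, forall e : R, 0 < e -> exists2 d : R, 0 < d & linear_approx g k a e
    d x) ->
  exists a, forall e : R, 0 < e -> exists2 d : R, 0 < d & linear_approx g k.+1 a
    e d x.
Proof.
move=> gL dx [a aP].
(* The index [k] shows that [n] is positive, so there are two points at positive distance and [L]
   cannot be negative. *)
have L0 : 0 <= L.
  have c1 : 0 < `|0 - const_mx 1 : V|.
    by apply: lt_le_trans (mx_entry_le_norm _ ord0 k); rewrite !mxE sub0r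
      normrN1.
  by have := le_trans (normr_ge0 _) (gL 0 (const_mx 1)); rewrite pmulr_lge0.
have [b] := derivable_approx (dx None); rewrite /rademacher_family/= => bP.
exists (\row_i if i == k then b else a ord0 i) => e e0.
have [p pe] := natSinv_small (divr_gt0 e0 (ltr0n R 4)).
have p0 : 0 < p.+1%:R^-1 :> R by rewrite invr_gt0.
set P : R := p.+1%:R^-1 in pe p0.
have [d1 d10 d1P] := aP _ (divr_gt0 p0 (ltr0n R 2)).
have n0 : 0 < n%:R :> R by rewrite ltr0n (leq_ltn_trans _ (ltn_ord k)).
(* Rounding each coefficient by at most [P / 2 / n%:R] changes the form by at most [P / 2] times the
   norm. *)
have c0 : 0 < P / 2 / n%:R by rewrite !divr_gt0.
have [ar arP] := rat_approx_mx a c0.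
have [q qd] := natSinv_small d10.
set A : V := map_mx ratr ar.
have aA y : `|dotp (a - A) y| <= P / 2 * `|y|.
  rewrite (le_trans (dotp_le y (ltW c0) _))// => [i|]; first by rewrite !mxE
    ltW.
  by rewrite mulrCA mulfV ?mulr1// gt_eqF.
pose E := linear_approx g k A P q.+1%:R^-1.
have Ex : E x.
  move=> y yk yq; have := d1P y yk (le_trans yq (ltW qd)); have := aA y.
  rewrite dotpDl dotpNl; move: (dotp a y) (dotp A y) (g _) (g x) `|y| => ? ? ? ?
    ?.
  by rewrite !ler_norml => /andP[? ?] /andP[? ?]; apply/andP; split; lra.
have M0 : 0 < 2 * L + 1 by rewrite ltr_wpDl// mulr_ge0.
(* Passing to a nearby point of [E] costs [L * (h * |s|)] twice, and the derivative along coordinate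
   [k] costs [h * |s|]; together this is [e / 2 * |s|]. *)
pose h := e / 2 / (2 * L + 1).
have h0 : 0 < h by rewrite !divr_gt0.
have [d2 d20 d2P] := set_dist_derivable0 Ex (dx (Some (ar, p, q))) h0.
have [d3 d30 d3P] := bP _ h0.
have q0 : 0 < q.+1%:R^-1 :> R by rewrite invr_gt0.
pose d := Num.min (Num.min d2 d3 / 2) q.+1%:R^-1.
exists d.
  by rewrite lt_min q0 andbT divr_gt0// lt_min d20.
move=> y' yk' yd'.
pose s := y' ord0 k; pose y : V := \row_i if i == k then 0 else y' ord0 i.
have y'E : y' = s *: delta_mx ord0 k + y.
  apply/rowP => i; rewrite !mxE eqxx /=; case: eqVneq => [->|_].
    by rewrite mulr1 addr0.
  by rewrite mulr0 add0r.
have ys : `|s| <= `|y'| by exact: mx_entry_le_norm.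
have yy : `|y| <= `|y'|.
  apply: mx_norm_le => // i j; rewrite mxE; case: eqP => _; first by rewrite
    normr0.
  exact: mx_entry_le_norm.
have yk : supported_below k y.
  move=> i ki; rewrite mxE; case: eqVneq => // ik; apply: yk'.
  by rewrite ltn_neqAle ki andbT eq_sym.
have sd : `|s| < d2 /\ `|s| < d3.
  have : `|s| <= Num.min d2 d3 / 2.
    by rewrite (le_trans ys)// (le_trans yd')// ge_min lexx.
  have : 0 < Num.min d2 d3 by rewrite lt_min d20.
  move=> m0 sm; have : `|s| < Num.min d2 d3.
    by rewrite (le_lt_trans sm)// ltr_pdivrMr// ltr_pMr// ltr1n.
  by rewrite lt_min => /andP.
have [z Ez zP] := d2P s sd.1.
have H3 := d3P s sd.2.
have yq : `|y| <= q.+1%:R^-1.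
  by rewrite (le_trans yy)// (le_trans yd')// ge_min lexx orbT.
have H1 := Ez y yk yq.
set w := x + s *: delta_mx ord0 k in zP H3.
have H4 : `|g (w + y) - g (z + y)| <= L * (h * `|s|).
  by rewrite (le_trans (gL _ _))// opprD addrACA subrr addr0 ler_wpM2l.
have H5 : `|g w - g z| <= L * (h * `|s|).
  by rewrite (le_trans (gL _ _))// ler_wpM2l.
have H6 := aA y.
have -> : x + y' = w + y by rewrite y'E addrA.
have -> : dotp (\row_i (if i == k then b else a ord0 i)) y' = s * b + dotp a y.
  rewrite /dotp (bigD1 k)//= [in RHS](bigD1 k)//= !mxE !eqxx mulr0 add0r mulrC.
  by congr (_ + _); apply: eq_bigr => i ik; rewrite !mxE (negbTE ik).
apply: (@le_trans _ _ ((2 * L + 1) * h * `|s| + (P + P) * `|y|)).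
  move: H1 H3 H4 H5 H6; rewrite dotpDl dotpNl.
  move: (g (w + y)) (g (z + y)) (g w) (g z) (g x) (dotp a y) (dotp A y) => ? ? ?
    ? ? ? ?.
  have : 0 <= P * `|y| by rewrite mulr_ge0// ltW.
  rewrite -/P; move: `|y| `|s| (s * b) => ? ? ? ?; rewrite !ler_norml.
  move=> /andP[? ?] /andP[? ?] /andP[? ?] /andP[? ?] /andP[? ?].
  by apply/andP; split; lra.
have -> : (2 * L + 1) * h = e / 2 by rewrite /h mulrC divfK// gt_eqF.
rewrite (@le_trans _ _ (e / 2 * `|y'| + (P + P) * `|y'|))//.
  by rewrite lerD// ler_wpM2l// ?ltW// ?divr_gt0// addr_gt0.
by rewrite -mulrDl ler_wpM2r//; lra.
Qed.

(** Induction on the number of coordinates: for [k = 0] only the zero increment is tested, for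
    [k = n] every increment is. *)
Lemma rademacher_criterion g (L : R) x :
  (forall x y, `|g x - g y| <= L * `|x - y|) ->
  (forall i, derivable (rademacher_family g i) x (delta_mx ord0 i.1)) ->
  exists a, forall e : R, 0 < e -> exists2 d : R, 0 < d &
    forall y, `|y| <= d -> `|g (x + y) - g x - dotp a y| <= e * `|y|.
Proof.
move=> gL dx.
suff H k : (k <= n)%N -> exists a, forall e : R, 0 < e ->
    exists2 d : R, 0 < d & linear_approx g k a e d x.
  have [a aP] := H n (leqnn n); exists a => e e0; have [d d0 dP] := aP e e0.
  by exists d => // y; apply: dP => i; rewrite leqNgt ltn_ord.
elim: k => [_|k ih kn].
  exists 0 => e e0; exists 1 => // y y0 _.
  have -> : y = 0 by apply/rowP => i; rewrite y0// mxE.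
  rewrite addr0 subrr /dotp big1 => [|i _]; last by rewrite mxE mul0r.
  by rewrite subrr !normr0 mulr0.
exact: (@linear_approx_step g L (Ordinal kn) x gL (fun o => dx (Ordinal kn, o))
  (ih (ltnW kn))).
Qed.

Lemma rademacher_family_lipschitz g (L : R) i :
  (forall x y, `|g x - g y| <= L * `|x - y|) ->
  forall x y, `|rademacher_family g i x - rademacher_family g i y| <=
    Num.max L 1 * `|x - y|.
Proof.
move=> gL x y; rewrite /rademacher_family; case: i.2 => [[[a p] q]|].
  by rewrite (le_trans (set_dist_lipschitz _ _ _))// ler_wpM2r// le_max lexx
    orbT.
by rewrite (le_trans (gL _ _))// ler_wpM2r// le_max lexx.
Qed.

End rademacher.

(** * Differentiability as first-order approximation *)

Lemma differentiable_of_linear (R : realType) (U W : normedModType R)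
    (f : U -> W) (x : U) (df : {linear U -> W}) : continuous df ->
  (forall e : R, 0 < e ->
    \forall y \near (0 : U), `|f (x + y) - f x - df y| <= e * `|y|) ->
  differentiable f x.
Proof.
move=> cdf H.
have fE : f \o shift x = cst (f x) + df +o_ 0 id.
  apply/eqaddoP => e e0; apply: filterS (H e e0) => y.
  by rewrite !fctE /= /shift/= [y + x]addrC opprD addrA.
have dE := diff_unique cdf fE.
by apply/diff_locallyP; rewrite dE.
Qed.

Section differentiability.
Context {R : realType} {n m : nat}.
Implicit Types (f : 'rV[R]_n -> 'rV[R]_m) (x y : 'rV[R]_n).

Lemma mulmx_norm_le (p : nat) (y : 'M[R]_(p, n)) (A : 'M[R]_(n, m)) :
  `|y *m A| <= n%:R * `|y| * `|A|.
Proof.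
apply: mx_norm_le => [|i j]; first by rewrite !mulr_ge0.
rewrite mxE (le_trans (ler_norm_sum _ _ _))//.
rewrite (@le_trans _ _ (\sum_(k < n) `|y| * `|A|))//.
  by apply: ler_sum => k _; rewrite normrM ler_pM// mx_entry_le_norm.
by rewrite sumr_const card_ord -[leLHS]mulr_natl mulrA.
Qed.

Lemma differentiable_approx f x : differentiable f x ->
  forall e : R, 0 < e -> exists2 d : R, 0 < d & forall y, `|y| < d ->
    `|f (x + y) - f x - y *m jacobian f x| <= e * `|y|.
Proof.
move=> /diff_locally /eqaddoP H e e0; have := H e e0.
move=> /nbhs_ballP[d /= d0 dP]; exists d => // y yd.
have := dP y; rewrite mx_norm_ball /ball_/= sub0r normrN => /(_ yd).
rewrite /jacobian mul_rV_lin1 !fctE /= /shift/= [y + x]addrC.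
by rewrite opprD addrA.
Qed.

Lemma differentiable_of_approx f x (A : 'M[R]_(n, m)) :
  (forall e : R, 0 < e -> exists2 d : R, 0 < d & forall y, `|y| <= d ->
    `|f (x + y) - f x - y *m A| <= e * `|y|) -> differentiable f x.
Proof.
move=> H.
pose df : {linear 'rV[R]_n -> 'rV[R]_m} := mulmxr A.
have cdf : continuous df.
  apply: (@lipschitz_continuous _ _ _ _ (n%:R * `|A|)) => y z /=.
  by rewrite -mulmxBl (le_trans (mulmx_norm_le _ _))// mulrAC.
apply: (differentiable_of_linear cdf) => e e0; have [d d0 dP] := H e e0.
apply/nbhs_ballP; exists d => // y.
by rewrite mx_norm_ball /ball_/= sub0r normrN => yd; exact/dP/ltW.
Qed.

End differentiability.

(** * The mean value inequality *)

Section mean_value.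
Context {R : realType} {n : nat}.
Local Notation V := 'rV[R]_n.
Local Notation mu := (@lebesgue_measure R).
Variables (f : V -> V) (L : R).
Hypothesis fL : forall x y, `|f x - f y| <= L * `|x - y|.

(** The Rademacher families of all components of [f] form a single countable family, so one nearby
    line serves them all. *)
Lemma generic_line_differentiable (x v : V) (e : R) : 0 < e ->
  exists2 y, `|x - y| <= e &
    {ae mu, forall t : R, differentiable f (y + t *: v)}.
Proof.
move=> e0.
have gL (c : 'I_n) x1 x2 : `|f x1 ord0 c - f x2 ord0 c| <= L * `|x1 - x2|.
  rewrite (le_trans _ (fL _ _))//.
  by rewrite (_ : _ - _ = (f x1 - f x2) ord0 c) ?mx_entry_le_norm// !mxE.
pose I := ('I_n * ('I_n * option ('rV[rat]_n * nat * nat)))%type.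
have [||y xy yP] := @generic_line_derivable R n I
  (fun i => rademacher_family (fun x => f x ord0 i.1) i.2)
  (fun=> Num.max L 1) (fun i => delta_mx ord0 i.2.1)
  [seq delta_mx ord0 k | k <- enum 'I_n] x v e _ _ e0.
- by move=> i; apply: rademacher_family_lipschitz; exact: gL.
- by move=> i; apply: map_f; rewrite mem_enum.
exists y => //; apply: ae_lebesgueS yP => t tP.
have H (c : 'I_n) := rademacher_criterion (gL c) (fun i => tP (c, i)).
have [a aP] := choice H.
apply: (@differentiable_of_approx _ _ _ _ _ (\matrix_(i, c) a c ord0 i)) => eps
  eps0.
have dE (c : 'I_n) : exists d : R, 0 < d /\ forall z : V, `|z| <= d ->
    `|f (y + t *: v + z) ord0 c - f (y + t *: v) ord0 c - dotp (a c) z| <= eps *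
      `|z|.
  by have [d d0 dP] := aP c eps eps0; exists d.
have [d dP] := choice dE.
exists (\big[Num.min/1]_c d c).
  by apply: lt_bigmin => // c _; exact: (dP c).1.
move=> z zd; apply: mx_norm_le => [|i c]; first by rewrite mulr_ge0// ltW.
rewrite (ord1 i) !mxE.
have := (dP c).2 z (le_trans zd (bigmin_le _ _ _)).
suff -> : \sum_j z ord0 j * (\matrix_(i0, c0) a c0 ord0 i0) j c = dotp (a c) z
  by [].
by apply: eq_bigr => j _; rewrite mxE mulrC.
Qed.

Lemma derive_of_approx (h : R -> R) (t l : R) :
  (forall e : R, 0 < e -> exists2 d : R, 0 < d & forall s : R, `|s| < d ->
    `|h (t + s) - h t - s * l| <= e * `|s|) -> 'D_1 h t = l.
Proof.
move=> H; apply/cvg_lim => //; apply/cvgrPdist_le => e e0.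
have [d d0 dP] := H e e0; exists d => // s /=; rewrite sub0r normrN => sd s0.
have := dP s sd; rewrite [s *: 1]mulr1 [s + t]addrC [_ *: _]/(_ * _).
set D := h _ - h t => HD.
have -> : l - s^-1 * D = - (s^-1 * (D - s * l)) by rewrite [in RHS]mulrBr
  mulKf// opprB.
by rewrite normrN normrM normfV ler_pdivrMl ?normr_gt0// [leRHS]mulrC.
Qed.

(** The segment itself may miss all differentiability points, so it is replaced by a nearby parallel
    one almost all of whose points are such. There the one-variable inequality applies, and the
    Lipschitz bound carries it back up to [e]. *)
Lemma mean_value_ge (x v w : V) (c r : R) : 0 < r ->
  (forall z, (exists2 t : R, 0 <= t <= 1 & `|x + t *: v - z| <= r) ->
    differentiable f z -> c <= dotp (v *m jacobian f z) w) ->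
  c <= dotp (f (x + v) - f x) w.
Proof.
move=> r0 H.
pose M := n%:R * `|w|.
have M0 : 0 <= M by rewrite mulr_ge0.
have dM (a : V) : `|dotp a w| <= M * `|a|.
  by rewrite dotpC dotp_le// => i; exact: mx_entry_le_norm.
have L0 : 0 <= `|L| + 1 by rewrite addr_ge0.
have fL' y z : `|f y - f z| <= (`|L| + 1) * `|y - z|.
  rewrite (le_trans (fL _ _))// ler_wpM2r// (le_trans (ler_norm L))// lerDl//.
have K0 : 0 < 2 * M * (`|L| + 1) + 1 by rewrite ltr_wpDl// !mulr_ge0.
apply/ler_addgt0Pr => e e0.
(* Moving both end points by at most [d] changes the pairing with [w] by at most
   [2 * M * (|L| + 1) * d], hence by at most [e]. *)
pose d := Num.min r (e / (2 * M * (`|L| + 1) + 1)).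
have d0 : 0 < d by rewrite lt_min r0 divr_gt0.
have [y xy yP] := generic_line_differentiable x v d0.
pose h t := dotp (f (y + t *: v)) w.
have hL s t : `|h s - h t| <= (M * ((`|L| + 1) * `|v|)) * `|s - t|.
  rewrite /h -dotpNl -dotpDl (le_trans (dM _))// -mulrA ler_wpM2l//.
  rewrite (le_trans (fL' _ _))// opprD addrACA subrr add0r -scalerBl normrZ.
  by rewrite -mulrA (mulrC `|v|).
have hc : {ae mu, forall t, `]0, 1[%classic t -> derivable h t 1 -> c <= 'D_1 h
  t}.
  apply: ae_lebesgueS yP => t dt; rewrite /= in_itv/= => /andP[t0 t1] _.
  rewrite (@derive_of_approx h t (dotp (v *m jacobian f (y + t *: v)) w)).
    apply: H dt; exists t; first by rewrite !ltW.
    by rewrite opprD addrACA subrr addr0 (le_trans xy)// ge_min lexx.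
  move=> eps eps0.
  have M1 : 0 < M * `|v| + 1 by rewrite ltr_wpDl// mulr_ge0.
  have v1 : 0 < `|v| + 1 by rewrite ltr_wpDl.
  have [del del0 delP] := differentiable_approx dt (divr_gt0 eps0 M1).
  exists (del / (`|v| + 1)); first by rewrite divr_gt0.
  move=> s sdel; rewrite /h scalerDl addrA.
  have := delP (s *: v); rewrite normrZ.
  have sv : `|s| * `|v| < del.
    rewrite (@le_lt_trans _ _ (`|s| * (`|v| + 1)))// ?ler_wpM2l ?lerDl//.
    by rewrite -ltr_pdivlMr.
  move=> /(_ sv); rewrite -scalemxAl => HH.
  have -> : s * dotp (v *m jacobian f (y + t *: v)) w =
      dotp (s *: (v *m jacobian f (y + t *: v))) w.
    by rewrite /dotp mulr_sumr; apply: eq_bigr => i _; rewrite !mxE mulrA.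
  rewrite -!dotpNl -!dotpDl (le_trans (dM _))//.
  rewrite (le_trans (ler_wpM2l M0 HH))//.
  have -> : M * (eps / (M * `|v| + 1) * (`|s| * `|v|)) =
      (eps * `|s|) * (M * `|v| / (M * `|v| + 1)) by ring.
  by apply: ler_piMr; [rewrite mulr_ge0// ltW|rewrite ler_pdivrMr// mul1r
    lerDl].
have := lipschitz_increment_ge hL hc; rewrite /h scale1r scale0r addr0.
rewrite -dotpNl -dotpDl => /le_trans; apply.
have -> : f (y + v) - f y = f (x + v) - f x + ((f (y + v) - f (x + v)) - (f y -
  f x)).
  by apply/rowP => i; rewrite !mxE; ring.
rewrite dotpDl lerD2l (le_trans (ler_norm _))// (le_trans (dM _))//.
rewrite (@le_trans _ _ (M * (2 * ((`|L| + 1) * d))))//.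
  rewrite ler_wpM2l// (le_trans (ler_normB _ _))// mulr2n mulrDl mul1r lerD//.
    rewrite (le_trans (fL' _ _))// ler_wpM2l// opprD addrACA subrr addr0.
    by rewrite distrC.
  by rewrite (le_trans (fL' _ _))// ler_wpM2l// distrC.
rewrite (@le_trans _ _ ((2 * M * (`|L| + 1) + 1) * d))//; first by nra.
by rewrite mulrC -ler_pdivlMr// ge_min lexx orbT.
Qed.

End mean_value.

(** * Euclidean norm and inner product *)

Section euclidean_norm.
Context {R : realType}.
Implicit Type n : nat.

Lemma dotpNr n (a y : 'rV[R]_n) : dotp a (- y) = - dotp a y.
Proof. by rewrite dotpC dotpNl dotpC. Qed.

Lemma dotpZl n (c : R) (a y : 'rV[R]_n) : dotp (c *: a) y = c * dotp a y.
Proof. by rewrite /dotp mulr_sumr; apply: eq_bigr => i _; rewrite mxE mulrA.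
  Qed.

Lemma dotpZr n (c : R) (a y : 'rV[R]_n) : dotp a (c *: y) = c * dotp a y.
Proof. by rewrite dotpC dotpZl dotpC. Qed.

Lemma dotp_ge0 n (a : 'rV[R]_n) : 0 <= dotp a a.
Proof. by apply: sumr_ge0 => i _; rewrite -expr2 sqr_ge0. Qed.

Lemma sqr_enorm n (x : 'rV[R]_n) : enorm x ^+ 2 = dotp x x.
Proof.
rewrite /enorm sqr_sqrtr; first by apply: eq_bigr => i _; rewrite expr2.
by apply: sumr_ge0 => i _; rewrite sqr_ge0.
Qed.

Lemma enorm_ge0 n (x : 'rV[R]_n) : 0 <= enorm x.
Proof. exact: sqrtr_ge0. Qed.

Lemma enormE n (x : 'rV[R]_n) : enorm x = Num.sqrt (dotp x x).
Proof. by rewrite -sqr_enorm sqrtr_sqr ger0_norm// enorm_ge0. Qed.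

Lemma enormZ n (c : R) (x : 'rV[R]_n) : enorm (c *: x) = `|c| * enorm x.
Proof.
by rewrite !enormE dotpZl dotpZr mulrA -expr2 sqrtrM ?sqr_ge0// sqrtr_sqr.
Qed.

Lemma enormN n (x : 'rV[R]_n) : enorm (- x) = enorm x.
Proof. by rewrite -scaleN1r enormZ normrN1 mul1r. Qed.

Lemma enorm0 n : enorm (0 : 'rV[R]_n) = 0.
Proof. by rewrite -(scale0r 0) enormZ normr0 mul0r. Qed.

Lemma enormB n (x y : 'rV[R]_n) : enorm (x - y) = enorm (y - x).
Proof. by rewrite -enormN opprB. Qed.

Lemma norm_le_enorm n (x : 'rV[R]_n) : `|x| <= enorm x.
Proof.
apply: mx_norm_le => [|i j]; first exact: enorm_ge0.
rewrite (ord1 i) -(@ler_pXn2r _ 2)// ?nnegrE ?enorm_ge0// sqr_enorm real_normK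
  ?num_real//.
rewrite /dotp (bigD1 j)//= -expr2 lerDl sumr_ge0// => k _.
by rewrite -expr2 sqr_ge0.
Qed.

Lemma enorm_le_norm n (x : 'rV[R]_n) : enorm x <= n%:R * `|x|.
Proof.
rewrite -(@ler_pXn2r _ 2)// ?nnegrE ?enorm_ge0 ?mulr_ge0// sqr_enorm.
have H := dotp_le x (normr_ge0 x) (mx_entry_le_norm x ord0).
rewrite (le_trans (ler_norm _))// (le_trans H)//.
rewrite -mulrA -expr2 exprMn ler_wpM2r ?sqr_ge0// -natrX ler_nat.
by case: (n) => // k; rewrite expnS expn1 leq_pmulr.
Qed.

Lemma enorm_eq0 n (x : 'rV[R]_n) : enorm x = 0 -> x = 0.
Proof.
by move=> x0; apply/eqP; rewrite -normr_le0 -x0 norm_le_enorm.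
Qed.

(** Cauchy-Schwarz, from the nonnegativity of the squared norm of
    [enorm y ^+ 2 *: x - dotp x y *: y]. *)
Lemma dotp_le_enorm n (x y : 'rV[R]_n) : dotp x y <= enorm x * enorm y.
Proof.
have [y0|y0] := eqVneq (enorm y) 0.
  rewrite (enorm_eq0 y0) enorm0 mulr0 /dotp big1// => i _.
  by rewrite mxE mulr0.
have yp : 0 < enorm y by rewrite lt_def y0 enorm_ge0.
have := dotp_ge0 (enorm y ^+ 2 *: x - dotp x y *: y).
rewrite !(dotpDl, dotpDr, dotpNl, dotpNr, dotpZl, dotpZr) (dotpC y x)
  -!sqr_enorm.
set a := enorm x; set b := enorm y; set c := dotp x y => H.
have {}H : 0 <= b ^+ 2 * (a ^+ 2 * b ^+ 2 - c ^+ 2).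
  by move: H; congr (0 <= _); ring.
rewrite pmulr_rge0 ?exprn_gt0// subr_ge0 -exprMn in H.
rewrite (le_trans (ler_norm _))// -(@ler_pXn2r _ 2)// ?nnegrE ?mulr_ge0
  ?enorm_ge0//.
by rewrite real_normK ?num_real.
Qed.

Lemma enormD n (x y : 'rV[R]_n) : enorm (x + y) <= enorm x + enorm y.
Proof.
rewrite -(@ler_pXn2r _ 2)// ?nnegrE ?addr_ge0 ?enorm_ge0//.
rewrite sqr_enorm dotpDl !dotpDr (dotpC y x) sqrrD -!sqr_enorm.
have := dotp_le_enorm x y; move: (dotp x y) (enorm x * enorm y) => ? ?; lra.
Qed.

Lemma enormB_le n (x y z : 'rV[R]_n) : enorm (x - z) <= enorm (x - y) + enorm (y
  - z).
Proof. by rewrite -(subrKA y) enormD. Qed.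

End euclidean_norm.

(** * Determinant, adjugate and eigenvalues *)

Section determinant_bounds.
Context {R : realType}.

Lemma det_norm_le (n : nat) (A : 'M[R]_n) (B : R) :
  (forall i j, `|A i j| <= B) -> `|\det A| <= #|{perm 'I_n}|%:R * B ^+ n.
Proof.
move=> AB; rewrite (le_trans (ler_norm_sum _ _ _))//.
rewrite (@le_trans _ _ (\sum_(s : {perm 'I_n}) B ^+ n))//; last first.
  by rewrite sumr_const -[leLHS]mulr_natl.
apply: ler_sum => s _; rewrite normrM normrX normrN1 expr1n mul1r.
rewrite normr_prod -[X in B ^+ X]card_ord -prodr_const.
by apply: ler_prod => i _; rewrite normr_ge0 AB.
Qed.

(** The identity [\det A *: v = v *m A *m \adj A] is combined with a bound on the entries of the
    adjugate. The constant depends on [n] and [B] only. *)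
Lemma adjugate_lower_bound (n : nat) (B : R) : exists2 k : R, 0 < k &
  forall A : 'M[R]_n, `|A| <= B -> forall v : 'rV[R]_n,
    k * `|\det A| * enorm v <= enorm (v *m A).
Proof.
(* For [n = 0] the general constant would be the inverse of [0], which is not positive. *)
have [n0|n0] := posnP n.
  exists 1 => // A _ v; suff -> : v = 0 by rewrite mul0mx !enorm0 mulr0.
  by subst n; apply/rowP => -[].
pose K := #|{perm 'I_n.-1}|%:R * `|B| ^+ n.-1 + 1.
have K0 : 0 < K by rewrite ltr_wpDl// mulr_ge0// exprn_ge0.
have nR : 0 < n%:R :> R by rewrite ltr0n.
exists (n%:R * n%:R * K)^-1; first by rewrite invr_gt0 !mulr_gt0.
move=> A AB v.
have adjK : `|\adj A| <= K.
  apply: mx_norm_le => [|i j]; first exact: ltW.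
  rewrite mxE normrM normrX normrN1 expr1n mul1r (le_trans (det_norm_le (B :=
    `|B|) _))//.
    by move=> k l; rewrite !mxE (le_trans (mx_entry_le_norm _ _ _))// (le_trans
      AB)// ler_norm.
  by rewrite lerDl.
have vE : \det A *: v = (v *m A) *m \adj A by rewrite -mulmxA mul_mx_adj
  mul_mx_scalar.
rewrite -mulrA mulrC ler_pdivrMr ?mulr_gt0// -enormZ vE.
rewrite (le_trans (enorm_le_norm _))// (le_trans (ler_wpM2l _ (mulmx_norm_le _
  _)))//.
rewrite (mulrC (enorm _)) -!mulrA !ler_wpM2l// mulrC ler_pM//.
exact: norm_le_enorm.
Qed.

Lemma normc_ge0 (z : R[i]) : 0 <= Normc.normc z.
Proof. by case: z => a b; exact: sqrtr_ge0. Qed.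

(** The modulus of the determinant is the product of the moduli of the [n] eigenvalues, so its
    [n]-th power is at least [s ^+ n]. *)
Lemma det_ge_eigenvalues (n : nat) (A : 'M[R]_n) (s : R) : (0 < n)%N -> 0 <= s
  ->
  (forall l, eigenvalue (map_mx (real_complex R) A) l -> s <= Normc.normc l ^+
    n) ->
  s <= `|\det A|.
Proof.
move=> n0 s0 H; set AC := map_mx _ A in H.
have [r rE] := closed_field_poly_normal (char_poly AC).
have lc1 : lead_coef (char_poly AC) = 1 by apply/monicP; exact: char_poly_monic.
rewrite lc1 scale1r in rE.
have sr : size r = n.
  by apply/eqP; rewrite -eqSS -(size_char_poly AC) rE size_prod_XsubC.
have rH l : l \in r -> s <= Normc.normc l ^+ n.
  by move=> lr; apply: H; rewrite eigenvalue_root_char rE root_prod_XsubC.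
have ncX (z : R[i]) k : Normc.normc (z ^+ k) = Normc.normc z ^+ k.
  elim: k => [|k ih]; first by rewrite !expr0 Normc.normc1.
  by rewrite !exprS Normc.normcM ih.
have detE : Normc.normc (\det AC) = \prod_(l <- r) Normc.normc l.
  have := char_poly_det AC; rewrite -horner_coef0 rE horner_prod => E.
  have N1 : Normc.normc (-1 : R[i]) = 1 by rewrite normcN Normc.normc1.
  have := congr1 (@Normc.normc R) E; rewrite Normc.normcM ncX N1 expr1n mul1r =>
    <-.
  rewrite (big_morph _ (@Normc.normcM R) (@Normc.normc1 R)); apply: eq_bigr => l
    _.
  by rewrite !hornerE normcN.
have -> : `|\det A| = Normc.normc (\det AC).
  by rewrite det_map_mx /Normc.normc/= expr0n/= addr0 sqrtr_sqr.
rewrite -(@ler_pXn2r _ n)// ?nnegrE ?normc_ge0// detE -prodrXl.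
have -> : s ^+ n = \prod_(l <- r) s by rewrite big_const_seq count_predT sr
  iter_mulr_1.
rewrite big_seq [leRHS]big_seq.
by apply: ler_prod => l lr; rewrite s0 rH.
Qed.

End determinant_bounds.

(** * Separation of a convex set from the origin *)

Section separation.
Context {R : realType} {n : nat}.
Local Notation V := 'rV[R]_n.

(* An almost minimal element of the convex set plays the role of the projection
   of the origin, so neither closedness nor compactness is needed. *)
Lemma convex_separation (S : set V) (s D : R) : 0 < s -> S !=set0 ->
  (forall x y (t : R), S x -> S y -> 0 <= t <= 1 -> S (x + t *: (y - x))) ->
  (forall x, S x -> s <= enorm x) -> (forall x, S x -> enorm x <= D) ->
  exists2 w : V, enorm w = 1 & forall x, S x -> 3 / 4 * s <= dotp x w.
Proof.
move=> s0 [x0 Sx0] Scvx Ss SD.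
have D0 : 0 < D by rewrite (lt_le_trans s0)// (le_trans (Ss _ Sx0))// SD.
have sD : s <= D by rewrite (le_trans (Ss _ Sx0))// SD.
(* Two points of [S] are at distance at most [2 * D], so this [t] bounds [t * dotp (x - u) (x - u)]
   by [s ^+ 2 / 4]. Together with the tolerance [t * s ^+ 2 / 4] on [u], it yields
   [dotp u (x - u) >= - (s ^+ 2 / 4)]. *)
pose t := s ^+ 2 / (16 * D ^+ 2).
have t0 : 0 < t by rewrite divr_gt0 ?mulr_gt0 ?exprn_gt0.
have tD : t * D ^+ 2 = s ^+ 2 / 16.
  by rewrite /t; field; rewrite gt_eqF.
have t1 : t <= 1.
  rewrite /t ler_pdivrMr ?mulr_gt0 ?exprn_gt0// mul1r.
  apply: (@le_trans _ _ (D ^+ 2)); first by rewrite ler_pXn2r// nnegrE ltW.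
  by rewrite ler_peMl ?exprn_ge0 ?ler1n// ltW.
pose Q := [set dotp x x | x in S].
have Qinf : has_inf Q.
  split; first by exists (dotp x0 x0); exists x0.
  by exists 0 => _ [x _ <-]; exact: dotp_ge0.
have e0 : 0 < t * s ^+ 2 / 4.
  by apply: divr_gt0 => //; apply: mulr_gt0 => //; exact: exprn_gt0.
have [_ [u Su <-] um] := inf_adherent e0 Qinf.
have u0 : 0 < enorm u by rewrite (lt_le_trans s0)// Ss.
exists ((enorm u)^-1 *: u).
  by rewrite enormZ normfV ger0_norm ?enorm_ge0// mulVf// gt_eqF.
move=> x Sx; rewrite dotpZr [leRHS]mulrC ler_pdivlMr// dotpC.
have H1 : inf Q <= dotp (u + t *: (x - u)) (u + t *: (x - u)).
  apply: ge_inf; first exact: Qinf.2.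
  by exists (u + t *: (x - u)) => //; apply: Scvx => //; rewrite t1 ltW.
have xu : dotp (x - u) (x - u) <= 4 * D ^+ 2.
  rewrite -sqr_enorm (_ : 4 * D ^+ 2 = (D + D) ^+ 2); last by ring.
  rewrite ler_pXn2r ?nnegrE ?enorm_ge0 ?addr_ge0 ?(ltW D0)//.
  by rewrite (le_trans (enormD _ _))// enormN lerD// SD.
move: H1; rewrite dotpDl !dotpDr !dotpZl !dotpZr (dotpC (x - u) u).
set c := dotp u (x - u); set E := dotp (x - u) (x - u) => H1.
have cE : dotp u x = c + dotp u u by rewrite /c -dotpDr subrK.
have uE : dotp u u = enorm u ^+ 2 by rewrite sqr_enorm.
rewrite cE uE; rewrite uE in H1 um.
have tE : t * E <= s ^+ 2 / 4.
  rewrite (le_trans (ler_wpM2l (ltW t0) xu))//.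
  by rewrite mulrCA tD; lra.
have tc : 0 <= t * (2 * c + s ^+ 2 / 2).
  have := ler_wpM2l (ltW t0) tE; move: H1 um; lra.
rewrite pmulr_rge0// in tc.
have su := Ss _ Su.
have : s * s <= s * enorm u by rewrite ler_wpM2l// ltW.
have : s * enorm u <= enorm u * enorm u by rewrite ler_wpM2r// ltW.
by rewrite !expr2 in tc *; lra.
Qed.

End separation.

(** * Limiting Jacobians and the Clarke differential *)

Section matrix_sequences.
Context {R : realType} {m1 m2 : nat}.

(** Flattened by [mxvec], the sequence stays in a closed ball of row vectors, which is compact. *)
Lemma bounded_matrix_cluster (B : nat -> 'M[R]_(m1, m2)) (b : R) :
  (forall k, `|B k| <= b) ->
  exists A, forall m : nat, exists2 k, (m <= k)%N & `|A - B k| < m.+1%:R^-1.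
Proof.
move=> Bb.
pose K : set 'rV[R]_(m1 * m2) := [set v | `|v| <= b].
have cK : compact K.
  apply: bounded_closed_compact.
    by exists b; split; [exact: num_real|move=> c bc v /= vb; rewrite (le_trans
      vb)// ltW].
  apply: (@preimage_closed _ _ (fun v : 'rV[R]_(m1 * m2) => `|v|) [set r : R | r
    <= b]).
    by move=> v _; exact: norm_continuous.
  exact: closed_le.
have [v [Kv cv]] : K `&` cluster ((fun k => mxvec (B k)) @ \oo) !=set0.
  apply: cK; exists 0%N => // k _ /=.
  apply: mx_norm_le; first exact: le_trans (Bb 0%N).
  move=> i j; case/mxvec_indexP: j => k0 l0; rewrite (ord1 i) mxvecE.
  by rewrite (le_trans (mx_entry_le_norm _ _ _)).
exists (vec_mx v) => m.
have m0 : 0 < m.+1%:R^-1 :> R by rewrite invr_gt0.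
have [] := cv [set w | exists2 k, (m <= k)%N & w = mxvec (B k)] (ball v
  m.+1%:R^-1).
- by exists m => // k /= mk; exists k.
- exact: nbhsx_ballx.
move=> w [[k mk ->]]; rewrite mx_norm_ball /ball_/= => vk.
exists k => //; apply: mx_norm_lt => // i j.
rewrite -[B k]mxvecK -raddfB mxE (le_lt_trans _ vk)//.
exact: mx_entry_le_norm.
Qed.

Lemma cvg_of_natSinv (u : nat -> 'M[R]_(m1, m2)) (x : 'M[R]_(m1, m2)) :
  (forall k, `|x - u k| < k.+1%:R^-1) -> u @ \oo --> x.
Proof.
move=> ux; apply/(@cvgrPdist_lt _ _ _ \oo _ u x) => e e0.
have [k ke] := natSinv_small e0; exists k => // l /= kl.
rewrite (lt_trans (ux l))// (le_lt_trans _ ke)// lef_pV2 ?posrE ?ltr0n//.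
by rewrite ler_nat ltnS.
Qed.

End matrix_sequences.

Section clarke.
Context {R : realType} {n : nat}.
Local Notation V := 'rV[R]_n.
Variables (f : V -> V) (L : R).
Hypothesis fL : forall x y, `|f x - f y| <= L * `|x - y|.

Lemma jacobian_norm_le (x : V) : differentiable f x -> `|jacobian f x| <= `|L|.
Proof.
move=> dx; apply: mx_norm_le => // i j; apply/ler_addgt0Pr => e e0.
have [d d0 dP] := differentiable_approx dx e0.
have d20 : 0 < d / 2 by rewrite divr_gt0.
pose y : V := (d / 2) *: delta_mx ord0 i.
have yn : `|y| <= d / 2.
  apply: mx_norm_le => [|k l]; first exact: ltW.
  rewrite !mxE normrM gtr0_norm// ler_piMr ?(ltW d20)//.
  by case: (_ && _); rewrite ?normr1 ?normr0.
have yd : `|y| < d by rewrite (le_lt_trans yn)// ltr_pdivrMr// ltr_pMr// ltr1n.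
have H1 := dP y yd; have H2 := fL (x + y) x.
rewrite (_ : x + y - x = y) in H2; last by rewrite addrC addKr.
have H3 : `|y *m jacobian f x| <= (`|L| + e) * (d / 2).
  have -> : y *m jacobian f x = (f (x + y) - f x) - (f (x + y) - f x - y *m
    jacobian f x).
    by rewrite subKr.
  rewrite (le_trans (ler_normB _ _))// mulrDl lerD//.
    rewrite (le_trans H2)// (le_trans (ler_wpM2r (normr_ge0 _) (ler_norm L)))//.
    by rewrite ler_wpM2l.
  by rewrite (le_trans H1)// ler_wpM2l// ltW.
have : `|(y *m jacobian f x) ord0 j| <= (`|L| + e) * (d / 2).
  by rewrite (le_trans (mx_entry_le_norm _ _ _)).
rewrite -scalemxAl mxE -rowE mxE normrM gtr0_norm// mulrC.
by rewrite ler_pM2r.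
Qed.

(** Otherwise the Jacobians at some points tending to [p] would stay [e]-far from all limiting ones,
    while, being bounded, they have a subsequence converging to one. *)
Lemma limiting_jacobians_usc (p : V) (e : R) : 0 < e ->
  exists2 d : R, 0 < d & forall x, `|p - x| < d -> differentiable f x ->
    exists2 A, limiting_jacobians f p A & `|A - jacobian f x| <= e.
Proof.
move=> e0; apply: contrapT => /forall2NP H.
have uE (k : nat) : exists x, [/\ `|p - x| < k.+1%:R^-1, differentiable f x &
    forall A, limiting_jacobians f p A -> e < `|A - jacobian f x|].
  have [k0|] := H k.+1%:R^-1; first by case: k0; rewrite invr_gt0.
  move=> /existsNP[x /not_implyP[px /not_implyP[dx /forall2NP noA]]].
  exists x; split => // A lA; have [//|] := noA A.
  by move=> /negP; rewrite -ltNge.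
have [u uP] := choice uE.
have [A AP] := @bounded_matrix_cluster _ _ _ (fun k => jacobian f (u k)) `|L|
  (fun k => jacobian_norm_le (let: And3 _ d _ := uP k in d)).
have phiE (m : nat) : exists k, (m <= k)%N /\ `|A - jacobian f (u k)| <
  m.+1%:R^-1.
  by have [k mk kP] := AP m; exists k.
have [phi phiP] := choice phiE.
have lA : limiting_jacobians f p A.
  exists (u \o phi); split.
  - apply: cvg_of_natSinv => k /=; have [h _ _] := uP (phi k).
    rewrite (lt_le_trans h)// lef_pV2 ?posrE ?ltr0n// ler_nat ltnS.
    exact: (phiP k).1.
  - by move=> k; have [_ ? _] := uP (phi k).
  - by apply: cvg_of_natSinv => k; exact: (phiP k).2.
have [k ke] := natSinv_small e0.
have [_ _ /(_ _ lA)] := uP (phi k).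
by rewrite ltNge => /negP; apply; rewrite ltW// (lt_trans (phiP k).2).
Qed.

Lemma differentiable_dense (p : V) (e : R) : 0 < e ->
  exists2 x, `|p - x| <= e & differentiable f x.
Proof.
(* A line with direction [0] is a single point, so the almost everywhere statement is about that
   point. *)
move=> e0; have [x px H] := generic_line_differentiable fL p 0 e0.
have [t _] := ae_exists_small (@ltr01 R) H; rewrite scaler0 addr0 => dx.
by exists x.
Qed.

Lemma limiting_jacobians_nonempty (p : V) : limiting_jacobians f p !=set0.
Proof.
have [d d0 dP] := limiting_jacobians_usc p (@ltr01 R).
have [x px dx] := differentiable_dense p (divr_gt0 d0 (ltr0n R 2)).
have [|A lA _] := dP x _ dx; last by exists A.
by rewrite (le_lt_trans px)// ltr_pdivrMr// ltr_pMr// ltr1n.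
Qed.

Lemma clarke_diff_convex (p : V) (A B : 'M[R]_n) (t : R) :
  clarke_diff f p A -> clarke_diff f p B -> 0 <= t <= 1 ->
  clarke_diff f p (A + t *: (B - A)).
Proof.
move=> CA CB /andP[t0 t1] M [cM sM].
have := cM B A (Itv01 t0 t1) (mem_set (CB M (conj cM sM))) (mem_set (CA M (conj
  cM sM))).
have -> : A + t *: (B - A) = t *: B + (1 - t) *: A.
  by rewrite scalerBl scale1r scalerBr addrCA.
by rewrite inE.
Qed.

(** A closed ball of matrices is convex and contains the limiting Jacobians. *)
Lemma clarke_diff_norm_le (p : V) (A : 'M[R]_n) : clarke_diff f p A -> `|A| <=
  `|L|.
Proof.
move: A; suff : clarke_diff f p `<=` [set A | `|A| <= `|L|] by exact.
apply: smallest_sub => [A B t /set_mem/= AL /set_mem/= BL|A [u [_ du uA]]].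
  apply/mem_set => /=.
  change (`|t%:num *: A + (1 - t%:num) *: B| <= `|L|).
  have t0 : 0 <= t%:num by [].
  have t1 : 0 <= 1 - t%:num by rewrite subr_ge0.
  rewrite (le_trans (ler_normD _ _))// !normrZ (ger0_norm t0) (ger0_norm t1).
  by have := ler_wpM2l t0 AL; have := ler_wpM2l t1 BL; lra.
apply/ler_addgt0Pr => e e0.
have /(@cvgrPdist_le _ _ _ \oo _) /(_ _ e0)[k _ /(_ k (leqnn k)) kP] := uA.
rewrite -(subrK (jacobian f (u k)) A) (le_trans (ler_normD _ _))// addrC lerD//.
exact: jacobian_norm_le.
Qed.

Lemma limiting_sub_clarke (p : V) : limiting_jacobians f p `<=` clarke_diff f p.
Proof. exact: sub_gen_smallest. Qed.

End clarke.

(** * Local expansion and absence of spurious local minima *)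

Section clarke_local.
Context {R : realType} {n : nat}.
Local Notation V := 'rV[R]_n.
Variables (f : V -> V) (L : R).
Hypothesis fL : forall x y, `|f x - f y| <= L * `|x - y|.

(** The map [T] stands for multiplication of a fixed vector by a matrix or by its transpose; [d] is
    fixed before [T], hence independent of the vector. Separation gives [3 / 4 * (s * c)] on the
    Clarke differential, and Jacobians near [p] are so close to limiting ones that at most
    [s / 4 * c] is lost. *)
Lemma clarke_direction (p : V) (s : R) : 0 < s -> exists2 d : R, 0 < d &
  forall (T : {linear 'M[R]_n -> V}) (c : R), 0 < c ->
    (forall M, enorm (T M) <= n%:R * n%:R * `|M| * c) ->
    (forall A, clarke_diff f p A -> s * c <= enorm (T A)) ->
    exists2 w : V, enorm w = 1 & forall x, `|p - x| < d -> differentiable f x ->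
      s / 2 * c <= dotp (T (jacobian f x)) w.
Proof.
move=> s0; pose N : R := n%:R * n%:R + 1.
have N0 : 0 < N by rewrite ltr_wpDl// mulr_ge0.
have e0 : 0 < s / 4 / N by rewrite !divr_gt0.
have [d d0 dP] := limiting_jacobians_usc fL p e0.
exists d => // T c c0 TM Ts.
have sc0 : 0 < s * c by rewrite mulr_gt0.
have [] := @convex_separation R n [set T A | A in clarke_diff f p] (s * c)
  (n%:R * n%:R * `|L| * c) sc0.
- have [A lA] := limiting_jacobians_nonempty fL p.
  by exists (T A); exists A => //; exact: limiting_sub_clarke.
- move=> _ _ t [A CA <-] [B CB <-] t01; exists (A + t *: (B - A)).
    exact: clarke_diff_convex.
  by rewrite linearD linearZ linearB.
- by move=> _ [A CA <-]; exact: Ts.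
- move=> _ [A CA <-]; rewrite (le_trans (TM A))// ler_wpM2r ?(ltW c0)//
  ler_wpM2l ?mulr_ge0//.
  exact: (clarke_diff_norm_le fL) CA.
move=> w w1 wP; exists w => // x px dx.
have [A lA AJ] := dP x px dx.
have := wP (T A) (ex_intro2 _ _ A (limiting_sub_clarke lA) erefl).
have -> : T (jacobian f x) = T A - T (A - jacobian f x) by rewrite linearB
  subKr.
rewrite dotpDl dotpNl.
have : dotp (T (A - jacobian f x)) w <= s / 4 * c.
  rewrite (le_trans (dotp_le_enorm _ _))// w1 mulr1 (le_trans (TM _))//.
  rewrite ler_wpM2r ?(ltW c0)// (@le_trans _ _ (N * (s / 4 / N)))//.
    by rewrite ler_pM// ?mulr_ge0// lerDl.
  by rewrite mulrC divfK// gt_eqF.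
move: (dotp (T A) w) (dotp _ w) => ? ?; lra.
Qed.

Lemma enorm_mulmx_le (v : V) (M : 'M[R]_n) :
  enorm (v *m M) <= n%:R * n%:R * `|M| * enorm v.
Proof.
rewrite (le_trans (enorm_le_norm _))// -!mulrA ler_wpM2l//.
rewrite (le_trans (mulmx_norm_le _ _))// -mulrA ler_wpM2l// mulrC ler_wpM2l//.
exact: norm_le_enorm.
Qed.

Lemma clarke_expanding (p : V) (s : R) : 0 < s ->
  (forall A, clarke_diff f p A -> forall v : V, s * enorm v <= enorm (v *m A))
    ->
  exists2 d : R, 0 < d & forall y z, `|p - y| < d -> `|p - z| < d ->
    s / 2 * enorm (y - z) <= enorm (f y - f z).
Proof.
move=> s0 H; have [d d0 dP] := clarke_direction p s0.
(* Points within [d / 2] of a segment whose ends lie in the ball of radius [d / 2] stay in the ball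
   of radius [d]. *)
have d20 : 0 < d / 2 by rewrite divr_gt0.
exists (d / 2) => // y z py pz.
have [yz|yz] := eqVneq (enorm (y - z)) 0; first by rewrite yz mulr0 enorm_ge0.
have c0 : 0 < enorm (y - z) by rewrite lt_def yz enorm_ge0.
have [w w1 wP] := dP (mulmx (y - z)) _ c0 (enorm_mulmx_le _) (fun A CA => H A CA
  _).
have := dotp_le_enorm (f y - f z) w; rewrite w1 mulr1; apply: le_trans.
rewrite -{2}(subrK z y) [y - z + z]addrC.
apply: (mean_value_ge fL d20) => x [t /andP[t0 t1] tx] dx; apply: wP => //.
have -> : p - x = (1 - t) *: (p - z) + t *: (p - y) + (z + t *: (y - z) - x).
  by apply/rowP => i; rewrite !mxE; ring.
rewrite (le_lt_trans (ler_normD _ _))// (splitr d) ltr_leD//.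
rewrite (le_lt_trans (ler_normD _ _))// !normrZ (ger0_norm t0) ger0_norm
  ?subr_ge0//.
have [->|t0'] := eqVneq t 0; first by rewrite subr0 mul1r mul0r addr0.
have tp : 0 < t by rewrite lt_def t0'.
have h1 : t * `|p - y| < t * (d / 2) by rewrite ltr_pM2l.
have h2 : (1 - t) * `|p - z| <= (1 - t) * (d / 2).
  by rewrite ler_wpM2l ?subr_ge0// ltW.
by move: h1 h2; lra.
Qed.

Lemma dotp_mulmx (v w : V) (A : 'M[R]_n) : dotp (w *m A^T) v = dotp (v *m A) w.
Proof.
rewrite /dotp; under eq_bigr do rewrite mxE mulr_suml.
rewrite exchange_big; apply: eq_bigr => j _; rewrite mxE mulr_suml.
by apply: eq_bigr => i _; rewrite mxE; ring.
Qed.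

(** If the residual [f z - y] were nonzero, its products with the transposed nearby Jacobians would
    all pair positively with one unit vector [v], uniformly. A small move along [- v] would then
    shorten the residual. *)
Lemma clarke_local_min (y z : V) (s r : R) : 0 < s -> 0 < r ->
  (forall A, clarke_diff f z A -> forall w : V, s * enorm w <= enorm (w *m A^T))
    ->
  (forall x, `|z - x| < r -> enorm (f z - y) <= enorm (f x - y)) -> f z = y.
Proof.
move=> s0 r0 H zmin; apply: contrapT => fzy.
pose w := f z - y.
have c0 : 0 < enorm w.
  rewrite lt_def enorm_ge0 andbT; apply/eqP => /enorm_eq0 /eqP.
  by rewrite subr_eq0 => /eqP.
have [d d0 dP] := clarke_direction z s0.
have [||v v1 vP] := dP (mulmx w \o trmx) _ c0.
- move=> M /=; rewrite (le_trans (enorm_mulmx_le _ _))//.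
  rewrite ler_wpM2r ?enorm_ge0// ler_wpM2l ?mulr_ge0//.
  by apply: mx_norm_le => // i j; rewrite mxE mx_entry_le_norm.
- by move=> A CA /=; exact: H.
pose k := s / 2 * enorm w.
have k0 : 0 < k by rewrite mulr_gt0// divr_gt0.
pose K := n%:R * `|L| + 1.
have K0 : 0 < K by rewrite ltr_wpDl// mulr_ge0.
have fK x x' : enorm (f x - f x') <= K * enorm (x - x').
  rewrite (le_trans (enorm_le_norm _))// (@le_trans _ _ (n%:R * `|L| * enorm (x
    - x')))//.
    rewrite -mulrA ler_wpM2l// (le_trans (fL _ _))//.
    rewrite (le_trans (ler_wpM2r (normr_ge0 _) (ler_norm L)))//.
    by rewrite ler_wpM2l// norm_le_enorm.
  by rewrite ler_wpM2r ?enorm_ge0// lerDl.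
(* The first two bounds keep the move inside both neighbourhoods. The third makes the quadratic term
   [(K * t) ^+ 2] at most [t * k], below the first-order gain [2 * (t * k)]. *)
pose t := Num.min (Num.min (r / 2) (d / 4)) (k / K ^+ 2).
have t0 : 0 < t by rewrite !lt_min !divr_gt0// exprn_gt0.
have tr : t <= r / 2 by rewrite !ge_min lexx.
have td : t <= d / 4 by rewrite !ge_min lexx orbT.
have tk : t * K ^+ 2 <= k by rewrite -ler_pdivlMr ?exprn_gt0// !ge_min lexx
  orbT.
pose x := z - t *: v.
have zx : enorm (z - x) = t by rewrite /x subKr enormZ v1 mulr1 gtr0_norm.
have vn : `|v| <= 1 by rewrite -v1 norm_le_enorm.
have dot : t * k <= dotp (f z - f x) w.
  have -> : z = x + t *: v by rewrite subrK.
  apply: (mean_value_ge fL (divr_gt0 d0 (ltr0n R 2))) => x' [a /andP[a0 a1] ax]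
    dx'.
  rewrite -scalemxAl dotpZl ler_pM2l// -dotp_mulmx.
  apply: vP => //.
  have -> : z - x' = (1 - a) *: (t *: v) + (x + a *: (t *: v) - x').
    by rewrite /x; apply/rowP => i; rewrite !mxE; ring.
  rewrite (le_lt_trans (ler_normD _ _))// (splitr d) ltr_leD//.
  rewrite !normrZ ger0_norm ?subr_ge0// (gtr0_norm t0).
  have h1 : t * `|v| <= t by rewrite ler_piMr// ltW.
  have h2 : (1 - a) * (t * `|v|) <= t * `|v|.
    by rewrite ler_piMl ?mulr_ge0 ?(ltW t0)// gerBl.
  by move: td h1 h2 d0; lra.
have zmin' : enorm w <= enorm (f x - y).
  apply: zmin; rewrite (le_lt_trans (norm_le_enorm _))// zx (le_lt_trans tr)//.
  by rewrite ltr_pdivrMr// ltr_pMr// ltr1n.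
have : enorm w ^+ 2 <= enorm (f x - y) ^+ 2 by rewrite ler_pXn2r// nnegrE
  enorm_ge0.
have -> : f x - y = w - (f z - f x) by rewrite /w; apply/rowP => i; rewrite
  !mxE; ring.
have fzx : dotp (f z - f x) (f z - f x) <= t * k.
  rewrite -sqr_enorm (@le_trans _ _ ((K * t) ^+ 2))//.
    rewrite ler_pXn2r ?nnegrE ?enorm_ge0 ?mulr_ge0 ?(ltW K0) ?(ltW t0)//.
    by rewrite -zx fK.
  by rewrite exprMn mulrC expr2 -mulrA ler_wpM2l ?(ltW t0).
have tk0 : 0 < t * k by rewrite mulr_gt0.
move: (f z - f x) dot fzx => a ? ?.
clearbody w; rewrite !sqr_enorm dotpDl !dotpDr !dotpNl !dotpNr (dotpC w a).
by move=> ?; lra.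
Qed.

End clarke_local.

(** * Compactness of Euclidean balls *)

Section euclidean_balls.
Context {R : realType} {n : nat}.
Local Notation V := 'rV[R]_n.

Lemma enorm_cluster (u : nat -> V) (x0 : V) (r : R) :
  (forall k, enorm (u k - x0) <= r) ->
  exists2 p, enorm (p - x0) <= r &
    forall (e : R) (m : nat), 0 < e -> exists2 k, (m <= k)%N & enorm (p - u k) <
      e.
Proof.
move=> ur.
have [|p pP] := @bounded_matrix_cluster R 1 n u (`|x0| + r).
  move=> k; rewrite -(subrKC x0 (u k)) (le_trans (ler_normD _ _))// lerD//.
  by rewrite (le_trans (norm_le_enorm _)).
have pE (e : R) (m : nat) : 0 < e -> exists2 k, (m <= k)%N & enorm (p - u k) <
  e.
  move=> e0; have n1 : 0 < n%:R + 1 :> R by rewrite ltr_wpDl.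
  have [q qe] := natSinv_small (divr_gt0 e0 n1).
  have [k mk kP] := pP (maxn m q); exists k.
    by rewrite (leq_trans _ mk)// leq_maxl.
  rewrite (le_lt_trans (enorm_le_norm _))//.
  rewrite (@le_lt_trans _ _ ((n%:R + 1) * `|p - u k|))//.
    by rewrite ler_wpM2r// lerDl.
  rewrite mulrC -ltr_pdivlMr// (lt_trans kP)// (le_lt_trans _ qe)//.
  by rewrite lef_pV2 ?posrE ?ltr0n// ler_nat ltnS leq_maxr.
exists p => //; apply/ler_addgt0Pr => e e0; have [k _ ke] := pE e 0%N e0.
by rewrite (le_trans (enormB_le _ (u k) _))// addrC lerD// ltW.
Qed.

Lemma enorm_ball_min (h : V -> R) (K : R) (p : V) (r : R) : 0 <= r ->
  (forall x y, `|h x - h y| <= K * enorm (x - y)) ->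
  exists2 z, enorm (z - p) <= r & forall x, enorm (x - p) <= r -> h z <= h x.
Proof.
move=> r0 hK; pose Q := [set h x | x in [set x | enorm (x - p) <= r]].
have K1 : 0 < `|K| + 1 by rewrite ltr_wpDl.
have hK' x y : `|h x - h y| <= (`|K| + 1) * enorm (x - y).
  rewrite (le_trans (hK _ _))// ler_wpM2r ?enorm_ge0//.
  by rewrite (le_trans (ler_norm K))// lerDl.
have Qinf : has_inf Q.
  split; first by exists (h p); exists p => //=; rewrite subrr enorm0.
  exists (h p - (`|K| + 1) * r) => _ [x /= xr <-].
  have := hK' p x; rewrite ler_norml enormB => /andP[_].
  by have := ler_wpM2l (ltW K1) xr; lra.
have uE (k : nat) : exists x, enorm (x - p) <= r /\ h x < inf Q + k.+1%:R^-1.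
  have k0 : 0 < k.+1%:R^-1 :> R by rewrite invr_gt0.
  by have [_ [x xr <-] xk] := inf_adherent k0 Qinf; exists x.
have [u uP] := choice uE.
have [z zr zP] := enorm_cluster (fun k => (uP k).1).
exists z => // x xr; apply: (@le_trans _ _ (inf Q)); last first.
  by apply: ge_inf; [exact: Qinf.2|exists x].
apply/ler_addgt0Pr => e e0.
have e20 : 0 < e / 2 by rewrite divr_gt0.
have [m me] := natSinv_small e20.
have [k mk zk] := zP _ m (divr_gt0 e20 K1).
have := hK' z (u k); have := (uP k).2.
have : k.+1%:R^-1 < e / 2.
  by rewrite (le_lt_trans _ me)// lef_pV2 ?posrE ?ltr0n// ler_nat ltnS.
have : (`|K| + 1) * enorm (z - u k) < e / 2 by rewrite mulrC -ltr_pdivlMr.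
move: (k.+1%:R^-1) (_ * enorm _) => ? ? ? ? ?; rewrite ler_norml => /andP[_];
  lra.
Qed.

End euclidean_balls.

(** * Global inversion by lifting segments *)

Section expanding_map.
Context {R : realType} {n : nat}.
Local Notation V := 'rV[R]_n.
Variables (f : V -> V) (K : R).
Hypothesis K_gt0 : 0 < K.
Hypothesis fK : forall x y, enorm (f x - f y) <= K * enorm (x - y).
Hypothesis local_min : forall (y z : V) (r : R), 0 < r ->
  (forall x, enorm (x - z) < r -> enorm (f z - y) <= enorm (f x - y)) -> f z =
    y.

(** The distance from [f z] to [y] is minimised over the closed ball. Expansion excludes a minimiser
    on the sphere, so [local_min] applies. *)
Lemma expanding_ball_image (p : V) (r m : R) : 0 < r -> 0 < m ->
  (forall y z, enorm (y - p) <= r -> enorm (z - p) <= r ->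
     m * enorm (y - z) <= enorm (f y - f z)) ->
  forall y, enorm (y - f p) < m * r / 2 ->
    exists2 z, f z = y & m * enorm (z - p) <= enorm (y - f p).
Proof.
move=> r0 m0 exp_f y yp.
have [|z zr zmin] := @enorm_ball_min R n (fun x => enorm (f x - y)) K p r (ltW
  r0).
  move=> x x'; apply: le_trans (fK x x').
  have h1 := enormB_le (f x) (f x') y; have h2 := enormB_le (f x') (f x) y.
  by rewrite (enormB (f x') (f x)) in h2; rewrite ler_norml; apply/andP; split;
    lra.
have pr : enorm (p - p) <= r by rewrite subrr enorm0 ltW.
(* On the sphere [f z] is at distance at least [m * r] from [f p], whereas minimality bounds this
   distance by [2 * enorm (y - f p)]. *)
have zr' : enorm (z - p) < r.
  rewrite lt_def zr andbT eq_sym; apply/eqP => zrE.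
  have h1 := exp_f z p zr pr; rewrite zrE in h1.
  have h2 := zmin p pr; have h3 := enormB_le (f z) y (f p).
  by rewrite (enormB (f p)) in h2; lra.
have fzy : f z = y.
  apply: (@local_min _ _ (r - enorm (z - p))); first by rewrite subr_gt0.
  move=> x xz; apply: zmin; have := enormB_le x z p; lra.
by exists z => //; rewrite -fzy exp_f.
Qed.

Section global.
Variables (x0 : V) (sg M : R -> R).
Hypothesis sg_gt0 : forall t, 0 <= t -> 0 < sg t.
Hypothesis sg_le : forall s t, 0 <= s -> s <= t -> sg t <= sg s.
Hypothesis expanding : forall p, exists2 d : R, 0 < d &
  forall y z, enorm (y - p) < d -> enorm (z - p) < d ->
    sg (enorm (p - x0)) * enorm (y - z) <= enorm (f y - f z).
Hypothesis M_le : forall s t, 0 <= s -> s <= t -> M s <= M t.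
Hypothesis M_incr : forall s t, 0 <= s -> s <= t -> M t - M s <= sg s * (t - s).
Hypothesis M_unbounded : forall C, exists2 t, 0 <= t & C < M t.

Let rad x := enorm (x - x0).

(** Compactness of the ball of radius [r] gives a common [d]. The shift by 1 in the argument of [sg]
    absorbs the replacement of [x] by a cluster point at distance less than 1. *)
Lemma expanding_uniform (r : R) : exists2 d : R, 0 < d & forall x, rad x <= r ->
  forall y z, enorm (y - x) < d -> enorm (z - x) < d ->
    sg (rad x + 1) * enorm (y - z) <= enorm (f y - f z).
Proof.
apply: contrapT => /forall2NP H.
have uE (k : nat) : exists x, rad x <= r /\ exists y z,
    [/\ enorm (y - x) < k.+1%:R^-1, enorm (z - x) < k.+1%:R^-1 &
      enorm (f y - f z) < sg (rad x + 1) * enorm (y - z)].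
  have [k0|] := H k.+1%:R^-1; first by case: k0; rewrite invr_gt0.
  move=> /existsNP[x /not_implyP[xr /existsNP[y /existsNP[z]]]].
  move=> /not_implyP[yx /not_implyP[zx /negP]]; rewrite -ltNge => h.
  by exists x; split => //; exists y, z.
have [u uP] := choice uE.
have [p pr pP] := enorm_cluster (fun k => (uP k).1).
have [d d0 dP] := expanding p.
have d20 : 0 < d / 2 by rewrite divr_gt0.
have [m md] := natSinv_small d20.
have e0 : 0 < Num.min (d / 2) 1 by rewrite lt_min d20 ltr01.
have [k mk] := pP _ m e0; rewrite lt_min => /andP[pd p1].
have kd : k.+1%:R^-1 < d / 2.
  by rewrite (le_lt_trans _ md)// lef_pV2 ?posrE ?ltr0n// ler_nat ltnS.
have [_ [y [z [yu zu fyz]]]] := uP k.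
rewrite enormB in pd.
have yp : enorm (y - p) < d by have := enormB_le y (u k) p; move: (k.+1%:R^-1)
  kd yu zu => ?; lra.
have zp : enorm (z - p) < d by have := enormB_le z (u k) p; move: (k.+1%:R^-1)
  kd yu zu => ?; lra.
have := dP y z yp zp; apply/negP; rewrite -ltNge (lt_le_trans fyz)//.
rewrite ler_wpM2r ?enorm_ge0// sg_le ?enorm_ge0//.
by have := enormB_le p (u k) x0; rewrite /rad; lra.
Qed.

(* The potential [M (rad x + 1)] grows at most as fast as the length of the
   image path, which confines the lifts of a bounded segment to a ball. *)
Lemma potential_step (x x' : V) (h : R) :
  sg (rad x + 1) * enorm (x' - x) <= h -> M (rad x' + 1) <= M (rad x + 1) + h.
Proof.
have rx : 0 <= rad x + 1 by rewrite addr_ge0 ?enorm_ge0.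
have rx' : 0 <= rad x' + 1 by rewrite addr_ge0 ?enorm_ge0.
move=> H; have h0 : 0 <= h.
  by rewrite (le_trans _ H)// mulr_ge0 ?enorm_ge0// ltW// sg_gt0.
have [xx'|xx'] := leP (rad x') (rad x).
  have x1 : rad x' + 1 <= rad x + 1 by rewrite lerD2r.
  by rewrite (le_trans (M_le rx' x1))// lerDl.
have x1 : rad x + 1 <= rad x' + 1 by rewrite lerD2r ltW.
rewrite -lerBlDl (le_trans (M_incr rx x1))//.
rewrite (le_trans _ H)// ler_wpM2l ?(ltW (sg_gt0 rx))//.
by have := enormB_le x' x x0; rewrite /rad; lra.
Qed.

(** The segment from [f x0] to [y] is lifted in finitely many equal steps, and [g y] is the end of
    the lift. The last clause, a local Lipschitz dependence on [y], later serves to identify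
    [g (f x)] with [x]. *)
Lemma segment_lift (Y : R) : 0 < Y -> exists g : V -> V, exists r m d : R,
  [/\ 0 < m, 0 < d,
    (forall x, rad x <= r -> forall y z, enorm (y - x) < d -> enorm (z - x) < d
      ->
      m * enorm (y - z) <= enorm (f y - f z)),
    g (f x0) = x0 &
    forall y, enorm (y - f x0) <= Y -> [/\ f (g y) = y, rad (g y) <= r &
      forall y', enorm (y' - f x0) <= Y -> enorm (y - y') < m * d / 4 ->
        m * enorm (g y - g y') <= enorm (y - y')]].
Proof.
move=> Y0; set y0 := f x0.
(* A lift starts at potential [M 1] and gains at most [Y], so it cannot leave the ball of radius
   [t]. *)
have [t t0 tM] := M_unbounded (M 1 + Y).
have [d d0 dP] := expanding_uniform t.
have m0 : 0 < sg (t + 1) by rewrite sg_gt0// addr_ge0.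
set m := sg (t + 1) in m0.
have msg x : rad x <= t -> m <= sg (rad x + 1).
  by move=> xt; rewrite sg_le ?lerD2r ?addr_ge0 ?enorm_ge0.
have expm x : rad x <= t -> forall y z, enorm (y - x) < d -> enorm (z - x) < d
  ->
    m * enorm (y - z) <= enorm (f y - f z).
  move=> xt y z yx zx; apply: le_trans (dP x xt y z yx zx).
  by rewrite ler_wpM2r ?enorm_ge0// msg.
(* Choosing the next point once for all pairs of current point and target makes the lift a function
   of [y]; outside the hypotheses its value is arbitrary. *)
have nxE (xy : V * V) : exists x', rad xy.1 <= t -> enorm (xy.2 - f xy.1) < m *
  d / 4 ->
    f x' = xy.2 /\ sg (rad xy.1 + 1) * enorm (x' - xy.1) <= enorm (xy.2 - f
      xy.1).
  case: xy => x y /=.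
  have [xt|] := pselect (rad x <= t); last by exists x.
  have [yx|] := pselect (enorm (y - f x) < m * d / 4); last by exists x.
  have d20 : 0 < d / 2 by rewrite divr_gt0.
  have dd : d / 2 < d by rewrite ltr_pdivrMr// ltr_pMr// ltr1n.
  have sg0 : 0 < sg (rad x + 1) by rewrite sg_gt0// addr_ge0 ?enorm_ge0.
  have [| |z fz zx] := @expanding_ball_image x (d / 2) (sg (rad x + 1)) d20 sg0
    _ y.
  - by move=> a b ax bx; apply: dP => //; [exact: le_lt_trans ax dd|exact:
    le_lt_trans bx dd].
  - rewrite (lt_le_trans yx)//.
    by have := ler_wpM2r (ltW d0) (msg x xt); lra.
  by exists z.
have [nx nxP] := choice nxE.
have md0 : 0 < m * d / 16 by rewrite !divr_gt0 ?mulr_gt0.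
have [N Ne] := natSinv_small (divr_gt0 md0 Y0).
rewrite ltr_pdivlMr// in Ne.
pose pt (k : nat) (y : V) := y0 + (k%:R / N.+1%:R) *: (y - y0).
pose G := fix G k y := if k is k'.+1 then nx (G k' y, pt k y) else x0.
have N0 : 0 < N.+1%:R :> R by rewrite ltr0n.
have ptS k y : pt k.+1 y - pt k y = N.+1%:R^-1 *: (y - y0).
  rewrite /pt opprD addrACA subrr add0r -scalerBl -mulrBl.
  by rewrite -natr1 addrC addKr mul1r.
have Ninv0 : 0 < N.+1%:R^-1 :> R by rewrite invr_gt0.
have step_small y : enorm (y - y0) <= Y ->
    N.+1%:R^-1 * enorm (y - y0) <= N.+1%:R^-1 * Y /\ N.+1%:R^-1 * enorm (y - y0)
      < m * d / 4.
  move=> yY; have h := ler_wpM2l (ltW Ninv0) yY; split => //.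
  by rewrite (lt_trans (le_lt_trans h Ne))//; move: md0; lra.
have Gstep k y : enorm (y - y0) <= Y -> f (G k y) = pt k y -> rad (G k y) <= t
  ->
    f (G k.+1 y) = pt k.+1 y /\ sg (rad (G k y) + 1) * enorm (G k.+1 y - G k y)
      <=
      N.+1%:R^-1 * enorm (y - y0).
  move=> yY fG rG; have [h1 h2] := step_small y yY.
  have dE : enorm (pt k.+1 y - f (G k y)) = N.+1%:R^-1 * enorm (y - y0).
    by rewrite fG ptS enormZ (gtr0_norm Ninv0).
  have /= := nxP (G k y, pt k.+1 y) rG.
  by rewrite dE => /(_ h2).
have G1 k y : (k <= N.+1)%N -> enorm (y - y0) <= Y ->
    [/\ f (G k y) = pt k y, rad (G k y) <= t &
      M (rad (G k y) + 1) <= M 1 + k%:R * (N.+1%:R^-1 * Y)].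
  move=> + yY; elim: k => [_|k ih kN].
    split; first by rewrite /pt mul0r scale0r addr0.
      by rewrite /rad subrr enorm0.
    by rewrite /= /rad subrr enorm0 add0r mul0r addr0.
  have [fG rG MG] := ih (ltnW kN).
  have [fG' dG] := Gstep k y yY fG rG.
  have [h1 _] := step_small y yY.
  have MG' : M (rad (G k.+1 y) + 1) <= M 1 + k.+1%:R * (N.+1%:R^-1 * Y).
    rewrite (le_trans (potential_step (le_trans dG h1)))//.
    by rewrite -[k.+1%:R]natr1 mulrDl mul1r addrA lerD2r.
  split => //; rewrite leNgt; apply/negP => tr.
  have h2 : M t <= M (rad (G k.+1 y) + 1) by apply: M_le => //; move: tr; lra.
  have : M 1 + k.+1%:R * (N.+1%:R^-1 * Y) <= M 1 + Y.
    by rewrite lerD2l mulrA ler_piMl ?(ltW Y0)// ler_pdivrMr// mul1r ler_nat.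
  by move=> /(le_trans (le_trans h2 MG')); rewrite leNgt tM.
have Gd k y : (k < N.+1)%N -> enorm (y - y0) <= Y ->
    m * enorm (G k.+1 y - G k y) <= N.+1%:R^-1 * enorm (y - y0).
  move=> kN yY; have [fG rG _] := G1 k y (ltnW kN) yY.
  have [_] := Gstep k y yY fG rG; apply: le_trans.
  by rewrite ler_wpM2r ?enorm_ge0// msg.
have Gs k y : (k < N.+1)%N -> enorm (y - y0) <= Y -> enorm (G k.+1 y - G k y) <
  d / 4.
  move=> kN yY; have := le_lt_trans (Gd k y kN yY) (step_small y yY).2.
  by rewrite -mulrA ltr_pM2l.
(* Both next points lie in the [d]-ball around [G k y], where [f] expands, so their distance is
   controlled by that of their images, which is a fraction of [enorm (y - y')]. *)
have G2 k y y' : (k <= N.+1)%N -> enorm (y - y0) <= Y -> enorm (y' - y0) <= Y ->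
    enorm (y - y') < m * d / 4 -> m * enorm (G k y - G k y') <= enorm (y - y').
  move=> + yY y'Y yy'; elim: k => [_|k ih kN].
    by rewrite /= subrr enorm0 mulr0 enorm_ge0.
  have h1 := Gs k y kN yY; have h2 := Gs k y' kN y'Y.
  have h3 : enorm (G k y' - G k y) < d / 4.
    by have := le_lt_trans (ih (ltnW kN)) yy'; rewrite enormB -mulrA ltr_pM2l.
  have [_ rG _] := G1 k y (ltnW kN) yY.
  have [fG _ _] := G1 k.+1 y kN yY; have [fG' _ _] := G1 k.+1 y' kN y'Y.
  rewrite (le_trans (expm (G k y) rG (G k.+1 y) (G k.+1 y') _ _))//.
  - by move: d0 h1; lra.
  - by have := enormB_le (G k.+1 y') (G k y') (G k y); move: d0 h2 h3; lra.
  rewrite fG fG' /pt opprD addrACA subrr add0r -scalerBr opprB addrA subrK.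
  rewrite enormZ ger0_norm ?divr_ge0// ler_piMl ?enorm_ge0//.
  by rewrite ler_pdivrMr// mul1r ler_nat.
exists (G N.+1), t, m, d; split => //.
  have y0Y : enorm (y0 - y0) <= Y by rewrite subrr enorm0 ltW.
  (* The segment from [y0] to itself has steps of length [0], so its lift is constant. *)
  suff H k : (k <= N.+1)%N -> G k y0 = x0 by exact: H.
  elim: k => // k ih kN; have := Gd k y0 kN y0Y.
  rewrite subrr enorm0 mulr0 pmulr_rle0// (ih (ltnW kN)) => h.
  by apply/eqP; rewrite -subr_eq0; apply/eqP/enorm_eq0/le_anti; rewrite h
    enorm_ge0.
move=> y yY; have [fG rG _] := G1 N.+1 y (leqnn _) yY; split => //.
  by rewrite fG /pt divff ?gt_eqF// scale1r subrKC.
by move=> y' y'Y; apply: G2.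
Qed.

(** Along the segment from [x0] to [x], the equality [g (f p) = p] propagates by small steps,
    because [g] varies little and [f] is injective on balls of radius [d]. *)
Lemma left_inverse_on_ball (Y : R) : 0 < Y -> exists g : V -> V,
  (forall y, enorm (y - f x0) <= Y -> f (g y) = y) /\
  (forall x, K * enorm (x - x0) <= Y -> g (f x) = x).
Proof.
move=> Y0; have [g [r [m [d [m0 d0 expm g0 gP]]]]] := segment_lift Y0.
exists g; split=> [y yY|x xY]; first by have [] := gP y yY.
have md0 : 0 < m * d / 4 by rewrite divr_gt0 ?mulr_gt0.
(* Steps below [e] keep consecutive points within [d] and, by the constant [K], their images within
   [m * d / 4]. *)
pose e := Num.min d (m * d / 4 / K).
have e0 : 0 < e by rewrite lt_min d0 divr_gt0.
have c0 : 0 < enorm (x - x0) + 1 by rewrite ltr_wpDl ?enorm_ge0.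
have [N Ne] := natSinv_small (divr_gt0 e0 c0).
have N0 : 0 < N.+1%:R :> R by rewrite ltr0n.
have Ninv0 : 0 < N.+1%:R^-1 :> R by rewrite invr_gt0.
pose pt (k : nat) := x0 + (k%:R / N.+1%:R) *: (x - x0).
have ptY k : (k <= N.+1)%N -> enorm (f (pt k) - f x0) <= Y.
  move=> kN; rewrite (le_trans (fK _ _))// (le_trans _ xY)// ler_wpM2l ?(ltW
    K_gt0)//.
  rewrite /pt addrC addKr enormZ ger0_norm ?divr_ge0// ler_piMl ?enorm_ge0//.
  by rewrite ler_pdivrMr// mul1r ler_nat.
have ptS k : enorm (pt k.+1 - pt k) < e.
  have -> : pt k.+1 - pt k = N.+1%:R^-1 *: (x - x0).
    rewrite /pt opprD addrACA subrr add0r -scalerBl -mulrBl.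
    by rewrite -natr1 addrC addKr mul1r.
  rewrite enormZ (gtr0_norm Ninv0).
  rewrite (@le_lt_trans _ _ (N.+1%:R^-1 * (enorm (x - x0) + 1)))//.
    by rewrite ler_wpM2l ?(ltW Ninv0)// lerDl.
  by rewrite -ltr_pdivlMr.
suff H k : (k <= N.+1)%N -> g (f (pt k)) = pt k.
  have := H _ (leqnn _); have -> // : pt N.+1 = x.
  by rewrite /pt divff ?gt_eqF// scale1r subrKC.
elim: k => [_|k ih kN]; first by rewrite /pt mul0r scale0r addr0.
have {}ih := ih (ltnW kN).
have := ptS k; rewrite lt_min => /andP[pd pmd].
rewrite ltr_pdivlMr// mulrC in pmd.
have fpt : enorm (f (pt k) - f (pt k.+1)) < m * d / 4.
  by rewrite (le_lt_trans (fK _ _))// enormB.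
have [_ rk gk] := gP (f (pt k)) (ptY k (ltnW kN)).
have [fg _ _] := gP (f (pt k.+1)) (ptY k.+1 kN).
have := gk _ (ptY k.+1 kN) fpt; rewrite ih in rk *; rewrite enormB => h.
have gd : enorm (g (f (pt k.+1)) - pt k) < d.
  have := le_lt_trans h fpt; rewrite -mulrA ltr_pM2l//; move: d0; lra.
have := expm (pt k) rk _ _ gd pd; rewrite fg subrr enorm0 pmulr_rle0// => h0.
by apply/eqP; rewrite -subr_eq0; apply/eqP/enorm_eq0/le_anti; rewrite h0
  enorm_ge0.
Qed.

(** The partial inverse depends on [Y], so injectivity and surjectivity are extracted from it
    separately, with [Y] adapted to the points at hand. *)
Lemma expanding_bijective : exists g : V -> V, cancel f g /\ cancel g f.
Proof.
have inj_f : injective f.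
  move=> x x' fxx'.
  pose Y := K * enorm (x - x0) + K * enorm (x' - x0) + 1.
  have a0 : 0 <= K * enorm (x - x0) by rewrite mulr_ge0 ?enorm_ge0// ltW.
  have b0 : 0 <= K * enorm (x' - x0) by rewrite mulr_ge0 ?enorm_ge0// ltW.
  have Y0 : 0 < Y by rewrite /Y; lra.
  have [g [_ gf]] := left_inverse_on_ball Y0.
  by rewrite -(gf x) ?fxx' ?gf// /Y; lra.
have surj_f y : exists x, f x = y.
  have Y0 : 0 < enorm (y - f x0) + 1 by rewrite ltr_wpDl ?enorm_ge0.
  have [g [fg _]] := left_inverse_on_ball Y0.
  by exists (g y); apply: fg; rewrite lerDl.
have [g gP] := choice surj_f.
by exists g; split => [x|//]; apply: inj_f.
Qed.

(** For the continuity of the inverse at [y], [expanding_ball_image] gives a preimage of a nearby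
    [z] at controlled distance from [g y]; by injectivity it is [g z]. *)
Lemma expanding_homeomorphism : homeomorphism f.
Proof.
split.
  apply: (@lipschitz_continuous _ _ _ _ (K * n%:R)) => x y.
  rewrite (le_trans (norm_le_enorm _))// (le_trans (fK _ _))// -mulrA.
  by rewrite ler_wpM2l ?(ltW K_gt0)// enorm_le_norm.
have [g [gf fg]] := expanding_bijective; exists g; split => // y.
have [d d0 dP] := expanding (g y).
have m0 := sg_gt0 (enorm_ge0 (g y - x0)); set m := sg _ in dP m0.
have d20 : 0 < d / 2 by rewrite divr_gt0.
have dd : d / 2 < d by rewrite ltr_pdivrMr// ltr_pMr// ltr1n.
have img := @expanding_ball_image (g y) (d / 2) m d20 m0
  (fun a b ax bx => dP a b (le_lt_trans ax dd) (le_lt_trans bx dd)).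
apply/(@cvgrPdist_le _ _ _ (nbhs y) (nbhs_filter y)) => e e0.
have n1 : 0 < n%:R + 1 :> R by rewrite ltr_wpDl.
pose r := Num.min (m * (d / 2) / 2) (m * e).
have r0 : 0 < r by rewrite lt_min divr_gt0 ?mulr_gt0.
apply/nbhs_ballP; exists (r / (n%:R + 1)); first exact: divr_gt0.
move=> z; rewrite mx_norm_ball /ball_/= => yz.
have : enorm (z - f (g y)) < r.
  rewrite fg enormB (le_lt_trans (enorm_le_norm _))//.
  rewrite (@le_lt_trans _ _ ((n%:R + 1) * `|y - z|))//.
    by rewrite ler_wpM2r// lerDl.
  by rewrite mulrC -ltr_pdivlMr.
rewrite lt_min => /andP[z1 z2]; have [x fx xz] := img z z1.
rewrite -fx gf (le_trans (norm_le_enorm _))// enormB -(ler_pM2l m0).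
by rewrite (le_trans xz)// ltW.
Qed.

End global.
End expanding_map.

(** * The integral as a potential *)

Section potential.
Context {R : realType}.
Local Notation mu := (@lebesgue_measure R).

Lemma nonincreasing_potential (q : R -> R) :
  (forall s t, s <= t -> q t <= q s) -> (forall t, 0 <= q t) ->
  (\int[mu]_(t in `[0%R, +oo[) (q t)%:E = +oo)%E ->
  exists M : R -> R, [/\ forall s t, 0 <= s -> s <= t -> M s <= M t,
    forall s t, 0 <= s -> s <= t -> M t - M s <= q s * (t - s) &
    forall C, exists2 t, 0 <= t & C < M t].
Proof.
move=> q_le q0 qint.
have mq : measurable_fun setT q by apply: nonincreasing_measurable => // s t;
  exact: q_le.
have iq (a b : R) : mu.-integrable `[a, b] (EFin \o q).
  apply: measurable_bounded_integrable.
  - exact: measurable_itv.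
  - rewrite [X in (X < _)%E]lebesgue_measure_itv/=; case: ifP => _; last exact:
    ltry.
    by rewrite -EFinB ltry.
  - exact: measurable_funTS.
  exists (q a); split; first exact: num_real.
  move=> c qc x /=; rewrite in_itv/= => /andP[ax _].
  by rewrite ger0_norm// (le_trans (q_le _ _ ax))// ltW.
pose M t := \int[mu]_(x in `[0, t]) q x.
have ME (s t : R) : 0 <= s -> s <= t -> M t - M s = \int[mu]_(x in `]s, t]) q x.
  by move=> s0 st; apply: Rintegral_itvB; [exact: iq|rewrite bnd_simp|rewrite
    bnd_simp].
have io (a b : R) : mu.-integrable `]a, b] (EFin \o q).
  by apply: integrableS (iq a b) => //; apply: subset_itvr; rewrite bnd_simp.
exists M; split.
- by move=> s t s0 st; rewrite -subr_ge0 ME// Rintegral_ge0.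
- move=> s t s0 st; rewrite ME//.
  have ic := integrable_cst_ocitv s t (q s).
  have := @le_Rintegral _ _ _ mu `]s, t]%classic q (cst (q s)) (measurable_itv
    _) (io s t) ic.
  rewrite Rintegral_cst; last exact: measurable_itv.
  have -> : fine (mu `]s, t]) = t - s.
    exact: (congr1 fine (lebesgue_stieltjes_measure_ocitv idfun st)).
  by apply => x /=; rewrite in_itv/= => /andP[sx _]; exact/q_le/ltW.
- move=> C; apply: contrapT => /forall2NP H.
  (* Were [M] bounded by [C], monotone convergence over the intervals from [0] to [k] would bound
     the improper integral. *)
  have cvgM := @ge0_cvgn_integral R mu q q0 mq.
  have : (\int[mu]_(t in `[0%R, +oo[) (q t)%:E <= C%:E)%E.
    rewrite -(cvg_lim _ cvgM)//; apply: lime_le; first by apply/cvg_ex; eexists;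
      exact: cvgM.
    apply: nearW => k; have [|/negP] := H k%:R; first by rewrite ler0n.
    rewrite -leNgt -lee_fin /M /Rintegral fineK//.
    exact: (integrable_fin_num _ (iq _ _)).
  by rewrite qint leye_eq.
Qed.

End potential.

(** * The spectral function, and the theorem *)

Section spectral_bound.
Context {R : realType} {n : nat}.
Local Notation V := 'rV[R]_n.
Variables (f : V -> V) (L : R) (x0 : V).
Hypothesis fL : forall x y, `|f x - f y| <= L * `|x - y|.
Hypothesis n_gt0 : (0 < n)%N.

Lemma spec_inf_ge0 t : (0 <= spec_inf f x0 t)%E.
Proof.
apply/ereal_infP => _ [x [l [_ _ ->]]]; rewrite lee_fin exprn_ge0//.
exact: normc_ge0.
Qed.

Lemma spec_inf_nonincreasing (s t : R) :
  s <= t -> (spec_inf f x0 t <= spec_inf f x0 s)%E.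
Proof.
move=> st; apply/ereal_infP => _ [x [l [xs xl ->]]].
by apply: ereal_inf_lbound; exists x, l; split => //; exact: le_trans xs st.
Qed.

Lemma spec_inf_le_det (x : V) (A : 'M[R]_n) : clarke_diff f x A ->
  (spec_inf f x0 (enorm (x - x0)) <= `|\det A|%:E)%E.
Proof.
move=> CA; have : (spec_inf f x0 (enorm (x - x0)) >= 0)%E := spec_inf_ge0 _.
have H l : eigenvalue (map_mx (real_complex R) A) l ->
    (spec_inf f x0 (enorm (x - x0)) <= (Normc.normc l ^+ n)%:E)%E.
  move=> lA; apply: ereal_inf_lbound; exists x, l; split => //.
    by rewrite /closed_ball_/= enormB.
  by exists A.
case: (spec_inf _ _ _) H => [s H s0|H _|//].
  by rewrite lee_fin; apply: det_ge_eigenvalues => // l /H; rewrite lee_fin.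
(* An infinite infimum would leave [A] without complex eigenvalues, but its characteristic
   polynomial has positive degree [n]. *)
set AC := map_mx _ _ in H.
have [l] : exists l, root (char_poly AC) l.
  by apply/closed_rootP; rewrite size_char_poly; case: (n) n_gt0.
by rewrite -eigenvalue_root_char => /H.
Qed.

Lemma spec_inf_fin_num (t : R) : 0 <= t -> spec_inf f x0 t \is a fin_num.
Proof.
move=> t0; have [A lA] := limiting_jacobians_nonempty fL x0.
rewrite ge0_fin_numE ?spec_inf_ge0//.
rewrite (le_lt_trans (spec_inf_nonincreasing t0))//.
have := spec_inf_le_det (limiting_sub_clarke lA); rewrite subrr enorm0.
by move=> /le_lt_trans; apply; exact: ltry.
Qed.

End spectral_bound.

Theorem theorem4p5 (R : realType) (n : nat) (f : 'rV[R]_n -> 'rV[R]_n)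
  (f_lip : is_lipschitz f)
  (f_rank : forall x : 'rV[R]_n, maximal_rank (clarke_diff f x))
  (f_int : exists x0 : 'rV[R]_n,
     (\int[@lebesgue_measure R]_(t in `[0%R, +oo[) spec_inf f x0 t = +oo)%E) :
  homeomorphism f.
Proof.
have [K0 fK0] := f_lip; have [x0 x0_int] := f_int.
pose K : R := `|K0| + 1.
have K_gt0 : 0 < K by rewrite ltr_wpDl.
have fK x y : enorm (f x - f y) <= K * enorm (x - y).
  rewrite (le_trans (fK0 _ _))// ler_wpM2r ?enorm_ge0//.
  by rewrite (le_trans (ler_norm _))// lerDl.
have fL x y : `|f x - f y| <= (K * n%:R) * `|x - y|.
  rewrite (le_trans (norm_le_enorm _))// (le_trans (fK _ _))// -mulrA.
  by rewrite ler_wpM2l ?(ltW K_gt0)// enorm_le_norm.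
have [n0|n_gt0] := posnP n.
  have V0 (x y : 'rV[R]_n) : x = y by subst n; apply/rowP => -[].
  split; first exact: lipschitz_continuous fL.
  by exists id; split=> [x|x|x]; [exact: V0|exact: V0|exact: cvg_id].
(* The maximum extends the function to negative arguments by its value at [0], which keeps it
   nonincreasing on the whole line. *)
pose q (t : R) : R := fine (spec_inf f x0 (Num.max t 0)).
have qE (t : R) : 0 <= t -> (q t)%:E = spec_inf f x0 t.
  by move=> t0; rewrite /q max_l// fineK// (spec_inf_fin_num x0 fL n_gt0).
have q_ge0 t : 0 <= q t by rewrite /q fine_ge0// spec_inf_ge0.
have q_le s t : s <= t -> q t <= q s.
  move=> st; rewrite /q fine_le ?(spec_inf_fin_num x0 fL n_gt0) ?le_max ?lexx
    ?orbT//.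
  by apply: spec_inf_nonincreasing; rewrite ge_max !le_max st lexx orbT.
have q_int : (\int[@lebesgue_measure R]_(t in `[0%R, +oo[) (q t)%:E = +oo)%E.
  rewrite -x0_int; apply: eq_integral => t; rewrite inE/= in_itv/= andbT.
  exact: qE.
have [M [M_le M_incr M_unb]] := nonincreasing_potential q_le q_ge0 q_int.
(* If [q t] were [0], then [M] would stay below [M t] from [t] on, contradicting its
   unboundedness. *)
have q_gt0 t : 0 <= t -> 0 < q t.
  move=> t0; rewrite lt_def q_ge0 andbT; apply/eqP => qt0.
  have [u u0 uM] := M_unb (M t).
  have tu : t <= u by rewrite leNgt; apply/negP => /ltW /(M_le _ _ u0); rewrite
    leNgt uM.
  by have := M_incr _ _ t0 tu; rewrite qt0 mul0r subr_le0 leNgt uM.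
have [k k_gt0 kP] := adjugate_lower_bound n `|K * n%:R|.
(* The bound for [A] yields local expansion, the one for its transpose excludes local minima with
   nonzero residual; both come from the same determinant. *)
have low x A : clarke_diff f x A -> forall v : 'rV[R]_n,
    k * q (enorm (x - x0)) * enorm v <= enorm (v *m A) /\
    k * q (enorm (x - x0)) * enorm v <= enorm (v *m A^T).
  move=> CA v; have A_le := clarke_diff_norm_le fL CA.
  have At_le : `|A^T| <= `|K * n%:R|.
    by apply: mx_norm_le => // i j; rewrite mxE (le_trans (mx_entry_le_norm _ _
      _)).
  have := spec_inf_le_det x0 n_gt0 CA; rewrite -qE ?enorm_ge0// lee_fin => qdet.
  have h B : `|B| <= `|K * n%:R| -> \det B = \det A ->
      k * q (enorm (x - x0)) * enorm v <= enorm (v *m B).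
    move=> B_le BA; rewrite (le_trans _ (kP B B_le v))// BA.
    by rewrite ler_wpM2r ?enorm_ge0// ler_wpM2l ?(ltW k_gt0).
  by split; apply: h => //; exact: det_tr.
have kq_gt0 t : 0 <= t -> 0 < k * q t by move=> t0; rewrite mulr_gt0// q_gt0.
(* Local expansion holds with half of [k * q], so the potential is scaled by [k / 2] accordingly. *)
apply: (@expanding_homeomorphism R n f K K_gt0 fK _ x0 (fun t => k * q t / 2)
  (fun t => k / 2 * M t)).
- move=> y z r r0 zmin.
  have n1 : 0 < n%:R + 1 :> R by rewrite ltr_wpDl.
  apply: (@clarke_local_min R n f (K * n%:R) fL y z (k * q (enorm (z - x0)))
    (r / (n%:R + 1))).
  + by rewrite kq_gt0// enorm_ge0.
  + exact: divr_gt0.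
  + by move=> A CA w; exact: (low z A CA w).2.
  + move=> x zx; apply: zmin; rewrite enormB (le_lt_trans (enorm_le_norm _))//.
    rewrite (@le_lt_trans _ _ ((n%:R + 1) * `|z - x|))//.
      by rewrite ler_wpM2r// lerDl.
    by rewrite mulrC -ltr_pdivlMr.
- by move=> t t0; rewrite divr_gt0// kq_gt0.
- by move=> s t s0 st; rewrite ler_wpM2r ?invr_ge0// ler_wpM2l ?(ltW k_gt0)//
  q_le.
- move=> p.
  have [d d0 dP] := @clarke_expanding R n f (K * n%:R) fL p (k * q (enorm (p -
    x0)))
    (kq_gt0 _ (enorm_ge0 _)) (fun A CA v => (low p A CA v).1).
  exists d => // y z yp zp; apply: dP.
  + by rewrite (le_lt_trans (norm_le_enorm _))// enormB.
  + by rewrite (le_lt_trans (norm_le_enorm _))// enormB.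
- by move=> s t s0 st; rewrite ler_wpM2l ?divr_ge0 ?(ltW k_gt0)// M_le.
- move=> s t s0 st; have k2 : 0 <= k / 2 by rewrite divr_ge0// ltW.
  by have := ler_wpM2l k2 (M_incr _ _ s0 st); lra.
- move=> C; have [t t0 tC] := M_unb (C / (k / 2)); exists t => //.
  by rewrite mulrC -ltr_pdivrMr// divr_gt0.
Qed.
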